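(* Let $(\mathcal A,\mathcal B)$ be a cotorsion pair in $\mathrm{Mod}\text{-}R$ such that $\mathcal B$ is closed under direct limits. Then a module $M$ is locally $\mathcal A^{\leq\omega}$-free if and only if $M$ is $\mathcal B$-stationary and is a pure-epimorphic image of a module from $\mathcal A$. In particular, the class of all locally $\mathcal A^{\leq\omega}$-free modules is closed under pure submodules.
   Context: All modules are right $R$-modules over a ring $R$; a cotorsion pair is $(\mathcal A,\mathcal B)$ with $\mathcal A={}^{\perp}\mathcal B$, $\mathcal B=\mathcal A^{\perp}$ (w.r.t. $\mathrm{Ext}^1_R$). $\mathcal A^{\leq\omega}$ is the class of countably presented modules in $\mathcal A$. A module $M$ is locally $\mathcal A^{\leq\omega}$-free if there is a family $\mathcal S$ of submodules of $M$, all in $\mathcal A^{\leq\omega}$, with $0\in\mathcal S$, closed under unions of countable chains, such that every countable subset of $M$ lies in a member of $\mathcal S$. An inverse system $(H_i,h_{ij})$ is Mittag-Leffler if for each $i$ there is $j\ge i$ with $\mathrm{Im}(h_{ik})=\mathrm{Im}(h_{ij})$ for all $k\ge j$. $M$ is $\mathcal B$-stationary if $M$ is the direct limit of a direct system $(F_i,f_{ji})$ of finitely presented modules such that for each $B\in\mathcal B$ the inverse system $(\mathrm{Hom}_R(F_i,B),\mathrm{Hom}_R(f_{ji},B))$ is Mittag-Leffler. *)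

(* Defs.v *)
(* Right R-modules are modelled as left modules over the
   converse ring R^c (so  r *: x  stands for  x r). *)
From HB Require Import structures.
From mathcomp Require Import all_boot all_order all_algebra.
Set Implicit Arguments. Unset Strict Implicit. Unset Printing Implicit Defensive.
Import GRing.Theory.
Local Open Scope ring_scope.

Section Modules.
Variable R : pzRingType.
Local Notation S := (R^c).

Definition rmod := lmodType S.
Definition mclass := rmod -> Prop.

Definition is_lin (M N : rmod) (f : M -> N) : Prop :=
  forall (a : S) (x y : M), f (a *: x + y) = a *: f x + f y.

Definition Ext1_zero (A B : rmod) : Prop :=
  forall (E : rmod) (i : B -> E) (p : E -> A),
    is_lin i -> is_lin p -> injective i -> (forall a, exists e, p e = a) ->
    (forall e, p e = 0 <-> exists b, i b = e) ->
    exists s : A -> E, is_lin s /\ forall a, p (s a) = a.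

Definition cotorsion_pair (A B : mclass) : Prop :=
  (forall M, A M <-> forall N, B N -> Ext1_zero M N) /\
  (forall N, B N <-> forall M, A M -> Ext1_zero M N).

Definition fin_presented (M : rmod) : Prop :=
  exists (n m : nat) (g : 'I_n -> M) (r : 'I_m -> 'I_n -> S),
    (forall x, exists c : 'I_n -> S, x = \sum_(i < n) c i *: g i) /\
    (forall k, \sum_(i < n) r k i *: g i = 0) /\
    (forall c : 'I_n -> S, \sum_(i < n) c i *: g i = 0 ->
       exists d : 'I_m -> S, forall i, c i = \sum_(k < m) d k * r k i).

(* countably presented: countably many generators g_0, g_1, ...,
   countably many relations (relation k has coefficients r k i, i < b k)
   generating the module of all relations *)
Definition count_presented (M : rmod) : Prop :=
  exists (g : nat -> M) (b : nat -> nat) (r : nat -> nat -> S),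
    (forall x, exists (n : nat) (c : nat -> S), x = \sum_(i < n) c i *: g i) /\
    (forall k, \sum_(i < b k) r k i *: g i = 0) /\
    (forall (n : nat) (c : nat -> S), \sum_(i < n) c i *: g i = 0 ->
       exists (m : nat) (d : nat -> S), forall i : nat,
         (if (i < n)%N then c i else 0) =
         \sum_(k < m) d k * (if (i < b k)%N then r k i else 0)).

Definition countable_part (A : mclass) : mclass :=
  fun M => A M /\ count_presented M.

(* the subset N of M is a submodule lying in the class C (up to the
   canonical identification of a submodule with a module) *)
Definition submodule_in (C : mclass) (M : rmod) (N : M -> Prop) : Prop :=
  exists (N' : rmod) (e : N' -> M),
    C N' /\ is_lin e /\ injective e /\ (forall x, N x <-> exists y, e y = x).

Definition memS (M : rmod) (SS : (M -> Prop) -> Prop) (N : M -> Prop) : Prop :=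
  exists N', SS N' /\ forall x, N' x <-> N x.

Definition locally_free (A : mclass) (M : rmod) : Prop :=
  exists SS : (M -> Prop) -> Prop,
    (forall N, SS N -> submodule_in (countable_part A) N) /\
    memS SS (fun x => x = 0) /\
    (forall C : nat -> (M -> Prop),
        (forall n, SS (C n)) ->
        (forall m n, (forall x, C m x -> C n x) \/ (forall x, C n x -> C m x)) ->
        memS SS (fun x => exists n, C n x)) /\
    (forall X : nat -> M, exists N, SS N /\ forall n, N (X n)).

Definition directed (I : Type) (le : I -> I -> Prop) : Prop :=
  (exists i : I, True) /\ (forall i, le i i) /\
  (forall i j k, le i j -> le j k -> le i k) /\
  (forall i j, exists k, le i k /\ le j k).

Definition direct_system (I : Type) (le : I -> I -> Prop) (F : I -> rmod)
    (f : forall i j, F i -> F j) : Prop :=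
  directed le /\
  (forall i j, le i j -> is_lin (f i j)) /\
  (forall i x, f i i x = x) /\
  (forall i j k, le i j -> le j k -> forall x, f j k (f i j x) = f i k x).

Definition is_dirlim (I : Type) (le : I -> I -> Prop) (F : I -> rmod)
    (f : forall i j, F i -> F j) (L : rmod) (g : forall i, F i -> L) : Prop :=
  (forall i, is_lin (g i)) /\
  (forall i j, le i j -> forall x, g j (f i j x) = g i x) /\
  (forall (N : rmod) (h : forall i, F i -> N),
     (forall i, is_lin (h i)) ->
     (forall i j, le i j -> forall x, h j (f i j x) = h i x) ->
     exists u : L -> N, is_lin u /\ (forall i x, u (g i x) = h i x) /\
       forall v : L -> N, is_lin v -> (forall i x, v (g i x) = h i x) ->
         forall y, v y = u y).

Definition closed_dirlim (C : mclass) : Prop :=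
  forall (I : Type) (le : I -> I -> Prop) (F : I -> rmod)
         (f : forall i j, F i -> F j) (L : rmod) (g : forall i, F i -> L),
    direct_system le f -> (forall i, C (F i)) -> is_dirlim le f g -> C L.

(* the inverse system (Hom(F_i, B), Hom(f_ji, B)) is Mittag-Leffler:
   Im(h_ik) is the set of maps F_i -> B of the form psi o f_ik, psi : F_k -> B *)
Definition hom_ML (I : Type) (le : I -> I -> Prop) (F : I -> rmod)
    (f : forall i j, F i -> F j) (B : rmod) : Prop :=
  forall i, exists j, le i j /\ forall k, le j k ->
    forall phi : F i -> B,
      (exists psi : F k -> B, is_lin psi /\ forall x, phi x = psi (f i k x)) <->
      (exists psi : F j -> B, is_lin psi /\ forall x, phi x = psi (f i j x)).

Definition stationary (Bc : mclass) (M : rmod) : Prop :=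
  exists (I : Type) (le : I -> I -> Prop) (F : I -> rmod)
         (f : forall i j, F i -> F j) (g : forall i, F i -> M),
    direct_system le f /\ (forall i, fin_presented (F i)) /\
    is_dirlim le f g /\
    forall B, Bc B -> hom_ML le f B.

Definition pure_epi (N M : rmod) (p : N -> M) : Prop :=
  is_lin p /\ (forall y, exists x, p x = y) /\
  forall (F : rmod) (phi : F -> M), fin_presented F -> is_lin phi ->
    exists psi : F -> N, is_lin psi /\ forall x, p (psi x) = phi x.

Definition pure_mono (N M : rmod) (e : N -> M) : Prop :=
  is_lin e /\ injective e /\
  forall (m n : nat) (a : 'I_m -> 'I_n -> S) (c : 'I_m -> N) (x : 'I_n -> M),
    (forall i, \sum_(j < n) a i j *: x j = e (c i)) ->
    exists y : 'I_n -> N, forall i, \sum_(j < n) a i j *: y j = c i.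

End Modules.

(* Main.v *)
(** Everything is reduced to conditions on finite systems of linear equations.
    Write a tuple x in M as x = w z with r z = 0, i.e. x is the image of a tuple
    of elements of the finitely presented module F' with relation matrix r.

    (S) M is B-stationary iff for every finite tuple x there is such a (w, r) which,
    in every module of B, implies the whole pp-type of x in M.  Uniformity over
    B comes from closure of B under products.

    (E) If M is in A, every map F -> M from a finitely presented F factors through
    a finitely presented F' such that Ext^1(F', B) -> Ext^1(F, B) vanishes for all
    B in the class B.  Otherwise the counterexamples, indexed by the finite sets j
    of relations of M, define a map from the module of all relations of M to
    the reduced product of the B_j along the directed set of the j; this reduced
    product is a direct limit of products, hence in B, so the map extends to the
    free module and lifts to the product of the B_j, which is absurd.  The same
    argument, with the kernel of the product onto the reduced product, gives (S)
    for M in A, with maps extending to all of M.  Both (S) and (E) pass to pure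
    submodules, and (E) passes to pure-epimorphic images.

    A module with (S) and (E) is locally free: iterating both conditions, every
    countable subset lies in the union L of a countable tower of finitely presented
    modules; (E) kills the Ext^1(F_t, B), (S) kills lim^1 of the Hom(F_t, B), so L is
    in A.  The limit of the tower embeds in M because B contains the injective
    modules, which cogenerate.  Conversely, a chain of members of the given family
    violating (S) would violate (S) for its union, which lies in A. *)
Require Import Defs.
From HB Require Import structures.
From mathcomp Require Import all_boot all_order all_algebra.
From mathcomp Require Import ring_quotient generic_quotient.
From mathcomp Require Import boolp classical_sets.
Set Implicit Arguments. Unset Strict Implicit. Unset Printing Implicit Defensive.
Import GRing.Theory.
Local Open Scope ring_scope.

(** * Linear maps and submodules given by predicates *)

Section LinearMaps.
Variable R : pzRingType.
Local Notation S := (R^c).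
Implicit Types M N V : rmod R.

Definition is_sub V (P : V -> Prop) : Prop :=
  P 0 /\ forall (a : S) (x y : V), P x -> P y -> P (a *: x + y).

(** Maps out of a submodule P are kept as total functions on V; their values outside P carry no
    information. *)
Definition lin_on V N (P : V -> Prop) (f : V -> N) : Prop :=
  forall (a : S) (x y : V), P x -> P y -> f (a *: x + y) = a *: f x + f y.

Lemma lin_onT V N (P : V -> Prop) (f : V -> N) : is_lin f -> lin_on P f.
Proof. by move=> fl a x y _ _; apply: fl. Qed.

Section Sub.
Variables (V : rmod R) (P : V -> Prop).
Hypothesis Ps : is_sub P.

Lemma sub0 : P 0. Proof. by case: Ps. Qed.

Lemma subD x y : P x -> P y -> P (x + y).
Proof. by move=> Px Py; rewrite -[x]scale1r; apply: Ps.2. Qed.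

Lemma subZ a x : P x -> P (a *: x).
Proof. by move=> Px; rewrite -[_ *: _]addr0; apply: Ps.2 => //; apply: sub0. Qed.

Lemma subN x : P x -> P (- x).
Proof. by move=> Px; rewrite -scaleN1r; apply: subZ. Qed.

Lemma subB x y : P x -> P y -> P (x - y).
Proof. by move=> Px Py; apply: subD => //; apply: subN. Qed.

Lemma sub_sum (I : Type) (r : seq I) (Q : pred I) (F : I -> V) :
  (forall i, Q i -> P (F i)) -> P (\sum_(i <- r | Q i) F i).
Proof. by move=> PF; apply: (big_ind P) => //; [exact: sub0 | exact: subD]. Qed.

End Sub.

Section LinOn.
Variables (V N : rmod R) (P : V -> Prop) (f : V -> N).
Hypotheses (Ps : is_sub P) (fl : lin_on P f).

Lemma lin_on0 : f 0 = 0.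
Proof.
have := fl (-1) (sub0 Ps) (sub0 Ps).
by rewrite scaler0 addr0 scaleN1r addNr.
Qed.

Lemma lin_onD x y : P x -> P y -> f (x + y) = f x + f y.
Proof. by move=> Px Py; have := fl 1 Px Py; rewrite !scale1r. Qed.

Lemma lin_onZ a x : P x -> f (a *: x) = a *: f x.
Proof. by move=> Px; have := fl a Px (sub0 Ps); rewrite lin_on0 !addr0. Qed.

Lemma lin_onB x y : P x -> P y -> f (x - y) = f x - f y.
Proof.
move=> Px Py; rewrite lin_onD //; last exact: subN.
by rewrite -scaleN1r lin_onZ // scaleN1r.
Qed.

Lemma lin_on_sum (I : Type) (r : seq I) (Q : pred I) (F : I -> V) :
  (forall i, Q i -> P (F i)) ->
  f (\sum_(i <- r | Q i) F i) = \sum_(i <- r | Q i) f (F i).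
Proof.
move=> PF; apply: (@proj2 (P (\sum_(i <- r | Q i) F i))).
apply: (big_ind2 (fun x y => P x /\ f x = y)).
- by split; [exact: sub0 | exact: lin_on0].
- by move=> x1 x2 y1 y2 [Px1 <-] [Py1 <-]; split; [exact: subD | exact: lin_onD].
- by move=> i Qi; split => //; apply: PF.
Qed.

End LinOn.

Definition whole V : V -> Prop := fun _ => True.

Lemma is_sub_whole V : is_sub (@whole V).
Proof. by []. Qed.

Section Lin.
Variables (V N : rmod R) (f : V -> N).
Hypothesis fl : is_lin f.
Let fT := @lin_onT V N (@whole V) f fl.

Lemma lin0 : f 0 = 0. Proof. exact: lin_on0 (is_sub_whole V) fT. Qed.
Lemma linD x y : f (x + y) = f x + f y. Proof. exact: lin_onD fT _ _ I I. Qed.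
Lemma linZ a x : f (a *: x) = a *: f x.
Proof. exact: lin_onZ (is_sub_whole V) fT _ _ I. Qed.
Lemma linN x : f (- x) = - f x.
Proof. by rewrite -scaleN1r linZ scaleN1r. Qed.
Lemma linB x y : f (x - y) = f x - f y.
Proof. exact: lin_onB (is_sub_whole V) fT _ _ I I. Qed.
Lemma lin_sum (J : Type) (r : seq J) (Q : pred J) (F : J -> V) :
  f (\sum_(i <- r | Q i) F i) = \sum_(i <- r | Q i) f (F i).
Proof. exact: lin_on_sum (is_sub_whole V) fT _ _ _ _ (fun _ _ => I). Qed.

End Lin.

Lemma is_lin_comp V M N (f : V -> M) (g : M -> N) :
  is_lin f -> is_lin g -> is_lin (fun x => g (f x)).
Proof. by move=> fl gl a x y; rewrite fl gl. Qed.

Lemma is_lin_sub V M (f g : V -> M) :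
  is_lin f -> is_lin g -> is_lin (fun x => f x - g x).
Proof. by move=> fl gl a x y; rewrite fl gl scalerBr opprD addrACA. Qed.

Lemma is_sub_eq0 V : is_sub (fun x : V => x = 0).
Proof. by split=> // a x y -> ->; rewrite scaler0 addr0. Qed.

Lemma is_sub_ker V M (f : V -> M) : is_lin f -> is_sub (fun x => f x = 0).
Proof.
by move=> fl; split=> [|a x y fx fy]; [exact: lin0 | rewrite fl fx fy scaler0 addr0].
Qed.

End LinearMaps.

(** * Subquotients *)

(* P / N is realised on a set of representatives in V, so that subquotients of
   a common module V can be compared through [sqval]. *)
Record sqdata (R : pzRingType) (V : rmod R) := SqData {
  sqP : V -> Prop;
  sqN : V -> Prop;
  sqP_sub : is_sub sqP;
  sqN_sub : is_sub sqN;
  sqNP : forall v, sqN v -> sqP v }.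

Section Subquotient.
Variables (R : pzRingType) (V : rmod R) (d : sqdata V).
Local Notation S := (R^c).
Local Notation P := (@sqP _ _ d).
Local Notation N := (@sqN _ _ d).
Let Ps : is_sub P := sqP_sub d.
Let Ns : is_sub N := sqN_sub d.

Definition sqrep (v : V) : V := xget 0 [set u | N (v - u)]%classic.

Lemma sqrepP v : N (v - sqrep v).
Proof.
rewrite /sqrep; case: xgetP => [u _ //|/(_ v)]; rewrite /= subrr => nN.
by case: nN; apply: sub0.
Qed.

(** Congruent elements have the same set of candidate representatives, so [xget] makes the same
    choice for both. *)
Lemma sqrep_eq u v : N (u - v) -> sqrep u = sqrep v.
Proof.
move=> Nuv; congr (xget 0 _); apply/seteqP; split=> w /= Nw.
  by rewrite -(subrK u v) -addrA; apply: subD => //; rewrite -opprB; apply: subN.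
by rewrite -(subrK v u) -addrA; apply: subD.
Qed.

Lemma sqrep_id v : sqrep (sqrep v) = sqrep v.
Proof. by apply/esym/sqrep_eq/sqrepP. Qed.

Lemma sqrep_in v : P v -> P (sqrep v).
Proof.
move=> Pv; rewrite -[sqrep v](subKr v); apply: subB => //.
by apply: sqNP; apply: sqrepP.
Qed.

Definition sqsort := {v : V | `[< P v /\ sqrep v = v >]}.
HB.instance Definition _ := gen_eqMixin sqsort.
HB.instance Definition _ := gen_choiceMixin sqsort.

Definition sqval (q : sqsort) : V := sval q.

Lemma sqval_in q : P (sqval q).
Proof. by case: q => v /= /asboolP []. Qed.

Lemma sqval_inj : injective sqval.
Proof. by move=> [u Pu] [v Pv] /= E; apply: eq_exist. Qed.

Definition sqmask (v : V) : V := if `[< P v >] then v else 0.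

Lemma sqmaskE v : P v -> sqmask v = v.
Proof. by move=> /asboolT; rewrite /sqmask => ->. Qed.

Lemma sqmask_in v : P (sqmask v).
Proof. by rewrite /sqmask; case: asboolP => // _; apply: sub0. Qed.

(* Junk value: [sqpi v = 0] when [v] is not in [P]. *)
Definition sqpi (v : V) : sqsort := exist _ (sqrep (sqmask v))
  (asboolT (conj (sqrep_in (sqmask_in v)) (sqrep_id _))).

Lemma sqval_pi v : P v -> N (v - sqval (sqpi v)).
Proof. by move=> Pv; rewrite /= sqmaskE //; apply: sqrepP. Qed.

Lemma sqvalK q : sqpi (sqval q) = q.
Proof.
apply: sqval_inj; rewrite /= sqmaskE; last exact: sqval_in.
by case: q => v /= /asboolP [].
Qed.

Lemma sqpi_eq u v : P u -> P v -> N (u - v) -> sqpi u = sqpi v.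
Proof. by move=> Pu Pv Nuv; apply: sqval_inj; rewrite /= !sqmaskE //; apply: sqrep_eq. Qed.

Lemma sqpi_inj u v : P u -> P v -> sqpi u = sqpi v -> N (u - v).
Proof.
move=> Pu Pv E; rewrite -(subrK (sqval (sqpi u)) u) -addrA; apply: subD => //.
  exact: sqval_pi.
by rewrite E -opprB; apply: subN => //; apply: sqval_pi.
Qed.

Let sadd (p q : sqsort) := sqpi (sqval p + sqval q).
Let sopp (p : sqsort) := sqpi (- sqval p).
Let sscale (a : S) (p : sqsort) := sqpi (a *: sqval p).

Let sadd_pi u v : P u -> P v -> sadd (sqpi u) (sqpi v) = sqpi (u + v).
Proof.
move=> Pu Pv; apply: sqpi_eq; try by apply: subD => //; apply: sqval_in.
rewrite -opprB; apply: subN => //; rewrite opprD addrACA.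
by apply: subD => //; apply: sqval_pi.
Qed.

Let sscale_pi a u : P u -> sscale a (sqpi u) = sqpi (a *: u).
Proof.
move=> Pu; apply: sqpi_eq; try by apply: subZ => //; apply: sqval_in.
by rewrite -scalerBr; apply: subZ => //; rewrite -opprB; apply: subN => //; apply: sqval_pi.
Qed.

Let saddA : associative sadd.
Proof.
move=> p q r; rewrite -[p]sqvalK -[q]sqvalK -[r]sqvalK.
by rewrite !sadd_pi ?addrA //; do ?[apply: subD => //]; apply: sqval_in.
Qed.

Let saddC : commutative sadd.
Proof. by move=> p q; rewrite /sadd addrC. Qed.

Let sadd0 : left_id (sqpi 0) sadd.
Proof.
move=> p; rewrite -[p]sqvalK sadd_pi ?add0r //; first exact: sub0.
exact: sqval_in.
Qed.

Let saddN : left_inverse (sqpi 0) sopp sadd.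
Proof.
move=> p; rewrite -{2}[p]sqvalK /sopp sadd_pi ?addNr //; last exact: sqval_in.
by apply: subN => //; apply: sqval_in.
Qed.

HB.instance Definition _ := GRing.isZmodule.Build sqsort saddA saddC sadd0 saddN.

Let sscaleA (a b : S) p : sscale a (sscale b p) = sscale (a * b) p.
Proof.
rewrite -[p]sqvalK !sscale_pi ?scalerA //; do ?[apply: subZ => //]; exact: sqval_in.
Qed.

Let sscale1 : left_id 1 sscale.
Proof. by move=> p; rewrite /sscale scale1r sqvalK. Qed.

Let sscaleDr : right_distributive sscale +%R.
Proof.
move=> a p q; rewrite -[p]sqvalK -[q]sqvalK.
have Pp := sqval_in p; have Pq := sqval_in q.
rewrite [sqpi _ + sqpi _]sadd_pi // !sscale_pi //; last exact: subD.
by rewrite [RHS]sadd_pi ?scalerDr //; apply: subZ.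
Qed.

Let sscaleDl p : {morph sscale^~ p : a b / a + b}.
Proof.
move=> a b; rewrite -[p]sqvalK; have Pp := sqval_in p.
by rewrite !sscale_pi // [RHS]sadd_pi ?scalerDl //; apply: subZ.
Qed.

HB.instance Definition _ :=
  GRing.Zmodule_isLmodule.Build S sqsort sscaleA sscale1 sscaleDr sscaleDl.

Definition SQ : rmod R := sqsort.

Lemma sqpi_lin : lin_on P (sqpi : V -> SQ).
Proof.
move=> a x y Px Py; have Pax := subZ Ps a Px.
by rewrite -(sadd_pi Pax Py) -(sscale_pi a Px).
Qed.

Lemma sqpi_eq0 v : N v -> sqpi v = 0 :> SQ.
Proof.
move=> Nv; apply: sqpi_eq; first exact: sqNP; first exact: sub0.
by rewrite subr0.
Qed.

Lemma sqpi_ker v : P v -> sqpi v = 0 :> SQ -> N v.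
Proof. by move=> Pv /(sqpi_inj Pv (sub0 Ps)); rewrite subr0. Qed.

(** Chosen representatives need not add up, so [sqval] is linear only modulo N; maps that vanish on
    N do not see the defect. *)
Lemma sqval_lin_mod a (p q : SQ) : N (sqval (a *: p + q) - (a *: sqval p + sqval q)).
Proof.
have Pp := sqval_in p; have Pq := sqval_in q.
apply: sqpi_inj; [exact: sqval_in| exact: Ps.2 |].
by rewrite sqpi_lin // !sqvalK.
Qed.

Lemma sqval_lin (M : rmod R) (f : V -> M) : lin_on P f -> (forall v, N v -> f v = 0) ->
  is_lin (fun q : SQ => f (sqval q)).
Proof.
move=> fl fN a p q; have Pp := sqval_in p; have Pq := sqval_in q.
apply/eqP; rewrite -subr_eq0 -fl //.
by rewrite -(lin_onB Ps fl) ?fN //; [exact: sqval_lin_mod | exact: sqval_in | exact: Ps.2].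
Qed.

Lemma sqval_pi_fun (M : rmod R) (f : V -> M) v : lin_on P f -> (forall v, N v -> f v = 0) ->
  P v -> f (sqval (sqpi v)) = f v.
Proof.
move=> fl fN Pv; apply/eqP; rewrite eq_sym -subr_eq0 -(lin_onB Ps fl) //.
  by rewrite fN //; apply: sqval_pi.
exact: sqval_in.
Qed.

End Subquotient.

(** * Submodules and quotients as special subquotients *)

Section Submodules.
Variables (R : pzRingType) (V : rmod R).

Definition subdata (P : V -> Prop) (Ps : is_sub P) : sqdata V.
Proof.
refine (@SqData R V P (fun v => v = 0) Ps (is_sub_eq0 V) _).
by move=> v ->; apply: sub0.
Defined.

Lemma subdata_val_lin P (Ps : is_sub P) :
  is_lin (fun q : SQ (subdata Ps) => sqval q).
Proof. by apply: (@sqval_lin _ _ (subdata Ps) V id). Qed.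

Lemma subdata_piK P (Ps : is_sub P) v : P v -> sqval (sqpi (subdata Ps) v) = v.
Proof. by move=> Pv; apply/eqP; rewrite eq_sym -subr_eq0; apply/eqP/(@sqval_pi _ _ (subdata Ps)). Qed.

Definition quodata (N : V -> Prop) (Ns : is_sub N) : sqdata V.
Proof. exact (@SqData R V (@whole R V) N (is_sub_whole V) Ns (fun _ _ => I)). Defined.

Lemma quodata_lin (N : V -> Prop) (Ns : is_sub N) :
  is_lin (sqpi (quodata Ns) : V -> SQ (quodata Ns)).
Proof. by move=> a x y; apply: sqpi_lin. Qed.

End Submodules.

(** * Products *)

Definition dprod_sort (R : pzRingType) (J : Type) (B : J -> rmod R) := forall j, B j.

Section Products.
Variables (R : pzRingType) (J : Type) (B : J -> rmod R).
Local Notation S := (R^c).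
Local Notation T := (dprod_sort B).

HB.instance Definition _ := gen_eqMixin T.
HB.instance Definition _ := gen_choiceMixin T.

Let dadd (f g : T) : T := fun j => f j + g j.
Let dopp (f : T) : T := fun j => - f j.
Let dzero : T := fun j => 0.
Let dscale (a : S) (f : T) : T := fun j => a *: f j.

Let daddA : associative dadd.
Proof. by move=> f g h; apply: functional_extensionality_dep => j; apply: addrA. Qed.
Let daddC : commutative dadd.
Proof. by move=> f g; apply: functional_extensionality_dep => j; apply: addrC. Qed.
Let dadd0 : left_id dzero dadd.
Proof. by move=> f; apply: functional_extensionality_dep => j; apply: add0r. Qed.
Let daddN : left_inverse dzero dopp dadd.
Proof. by move=> f; apply: functional_extensionality_dep => j; apply: addNr. Qed.

HB.instance Definition _ := GRing.isZmodule.Build T daddA daddC dadd0 daddN.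

Let dscaleA (a b : S) f : dscale a (dscale b f) = dscale (a * b) f.
Proof. by apply: functional_extensionality_dep => j; apply: scalerA. Qed.
Let dscale1 : left_id 1 dscale.
Proof. by move=> f; apply: functional_extensionality_dep => j; apply: scale1r. Qed.
Let dscaleDr : right_distributive dscale +%R.
Proof. by move=> a f g; apply: functional_extensionality_dep => j; apply: scalerDr. Qed.
Let dscaleDl f : {morph dscale^~ f : a b / a + b}.
Proof. by move=> a b; apply: functional_extensionality_dep => j; apply: scalerDl. Qed.

HB.instance Definition _ :=
  GRing.Zmodule_isLmodule.Build S T dscaleA dscale1 dscaleDr dscaleDl.

Definition dprod : rmod R := T.

Lemma dprod_ext (f g : dprod) : (forall j, f j = g j) -> f = g.
Proof. exact: functional_extensionality_dep. Qed.

Lemma dprodE a (f g : dprod) j : (a *: f + g) j = a *: f j + g j.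
Proof. by []. Qed.

Lemma dprodZ a (f : dprod) j : (a *: f) j = a *: f j.
Proof. by []. Qed.

Lemma dprodB (f g : dprod) j : (f - g) j = f j - g j.
Proof. by []. Qed.

Lemma dprod0 j : (0 : dprod) j = 0.
Proof. by []. Qed.

Lemma is_lin_proj j : is_lin (fun f : dprod => f j).
Proof. by []. Qed.

Lemma is_lin_tuple (V : rmod R) (h : forall j, V -> B j) :
  (forall j, is_lin (h j)) -> is_lin (fun v => (fun j => h j v) : dprod).
Proof. by move=> hl a x y; apply: dprod_ext => j; rewrite hl. Qed.

(** The family depends on the index, so b must be transported along a proof of [j0 = j]; classical
    logic decides whether there is one. *)
Definition dsingle (j0 : J) (b : B j0) : dprod := fun j =>
  match pselect (j0 = j) with
  | left e => eq_rect j0 (fun j => B j) b j e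
  | right _ => 0
  end.

Lemma dsingle_eq j0 (b : B j0) : dsingle b j0 = b.
Proof.
rewrite /dsingle; case: pselect => // e.
by rewrite (Prop_irrelevance e erefl).
Qed.

Lemma dsingle_neq j0 (b : B j0) j : j0 <> j -> dsingle b j = 0.
Proof. by rewrite /dsingle; case: pselect. Qed.

Lemma dsingle_lin j0 : is_lin (@dsingle j0).
Proof.
move=> a x y; apply: dprod_ext => j; rewrite dprodE.
have [<-|ne] := pselect (j0 = j); first by rewrite !dsingle_eq.
by rewrite !dsingle_neq // scaler0 addr0.
Qed.

End Products.

(** * Matrices acting on tuples of module elements *)

Definition mact (R : pzRingType) (M : rmod R) m n (a : 'M[R^c]_(m, n))
    (x : 'cV[M]_n) : 'cV[M]_m :=
  \col_i \sum_j a i j *: x j 0.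

Notation "a *v x" := (mact a x) (at level 40, left associativity) : ring_scope.

Section MatrixAction.
Variable R : pzRingType.
Local Notation S := (R^c).
Implicit Types M N B V : rmod R.

Lemma mactE M m n (a : 'M[S]_(m, n)) (x : 'cV[M]_n) i j :
  (a *v x) i j = \sum_k a i k *: x k 0.
Proof. by rewrite mxE. Qed.

Lemma colP0 (T : Type) n (x y : 'cV[T]_n) : (forall i, x i 0 = y i 0) -> x = y.
Proof. by move=> E; apply/matrixP => i j; rewrite ord1. Qed.

Lemma colB (V : zmodType) n (x y : 'cV[V]_n) i : (x - y) i 0 = x i 0 - y i 0.
Proof. by rewrite !mxE. Qed.

Lemma colD (V : zmodType) n (x y : 'cV[V]_n) i : (x + y) i 0 = x i 0 + y i 0.
Proof. by rewrite !mxE. Qed.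

Lemma mactA M m n p (a : 'M[S]_(m, n)) (b : 'M[S]_(n, p)) (x : 'cV[M]_p) :
  (a *m b) *v x = a *v (b *v x).
Proof.
apply: colP0 => i; rewrite !mactE.
under eq_bigr do rewrite mxE scaler_suml.
rewrite exchange_big; apply: eq_bigr => k _; rewrite mactE scaler_sumr.
by apply: eq_bigr => j _; rewrite scalerA.
Qed.

Lemma mact1 M n (x : 'cV[M]_n) : 1%:M *v x = x.
Proof.
apply: colP0 => i; rewrite mactE (bigD1 i) //= mxE eqxx scale1r big1 ?addr0 //.
by move=> j /negPf ne; rewrite mxE eq_sym ne scale0r.
Qed.

Lemma mactDr M m n (a : 'M[S]_(m, n)) (x y : 'cV[M]_n) :
  a *v (x + y) = a *v x + a *v y.
Proof.
apply: colP0 => i; rewrite !mxE -big_split; apply: eq_bigr => k _.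
by rewrite !mxE scalerDr.
Qed.

Lemma mactBr M m n (a : 'M[S]_(m, n)) (x y : 'cV[M]_n) :
  a *v (x - y) = a *v x - a *v y.
Proof.
apply: colP0 => i; rewrite !mxE -sumrB; apply: eq_bigr => k _.
by rewrite !mxE scalerBr.
Qed.

Lemma mactDl M m n (a b : 'M[S]_(m, n)) (x : 'cV[M]_n) :
  (a + b) *v x = a *v x + b *v x.
Proof.
apply: colP0 => i; rewrite !mxE -big_split; apply: eq_bigr => k _.
by rewrite !mxE scalerDl.
Qed.

Lemma mactBl M m n (a b : 'M[S]_(m, n)) (x : 'cV[M]_n) :
  (a - b) *v x = a *v x - b *v x.
Proof.
apply: colP0 => i; rewrite !mxE -sumrB; apply: eq_bigr => k _.
by rewrite !mxE scalerBl.
Qed.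

Lemma mactZl M m n (c : S) (a : 'M[S]_(m, n)) (x : 'cV[M]_n) i :
  ((c *: a) *v x) i 0 = c *: (a *v x) i 0.
Proof.
by rewrite !mactE scaler_sumr; apply: eq_bigr => k _; rewrite mxE scalerA.
Qed.

Lemma mact0r M m n (a : 'M[S]_(m, n)) : a *v (0 : 'cV[M]_n) = 0.
Proof. by have := mactBr a 0 (0 : 'cV[M]_n); rewrite !subrr. Qed.

Lemma mact0l M m n (x : 'cV[M]_n) : (0 : 'M[S]_(m, n)) *v x = 0.
Proof. by have := mactBl 0 (0 : 'M[S]_(m, n)) x; rewrite !subrr. Qed.

Lemma mact_col M m1 m2 n (a : 'M[S]_(m1, n)) (b : 'M[S]_(m2, n)) (x : 'cV[M]_n) :
  col_mx a b *v x = col_mx (a *v x) (b *v x).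
Proof.
apply: colP0 => i; case: (split_ordP i) => j ->;
  rewrite ?col_mxEu ?col_mxEd !mactE; apply: eq_bigr => k _;
  by rewrite ?col_mxEu ?col_mxEd.
Qed.

Lemma mact_row M m n1 n2 (a : 'M[S]_(m, n1)) (b : 'M[S]_(m, n2))
    (x : 'cV[M]_n1) (y : 'cV[M]_n2) :
  row_mx a b *v col_mx x y = a *v x + b *v y.
Proof.
apply: colP0 => i; rewrite [RHS]mxE !mactE big_split_ord /=; congr (_ + _);
  by apply: eq_bigr => k _; rewrite ?row_mxEl ?row_mxEr ?col_mxEu ?col_mxEd.
Qed.

Definition all_in V (P : V -> Prop) n (x : 'cV[V]_n) := forall i, P (x i 0).

Lemma all_in_mact V (P : V -> Prop) m n (a : 'M[S]_(m, n)) (x : 'cV[V]_n) :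
  is_sub P -> all_in P x -> all_in P (a *v x).
Proof.
by move=> Ps Px i; rewrite mactE; apply: sub_sum => // k _; apply: subZ.
Qed.

Lemma all_in_col V (P : V -> Prop) m n (x : 'cV[V]_m) (y : 'cV[V]_n) :
  all_in P x -> all_in P y -> all_in P (col_mx x y).
Proof. by move=> Px Py i; rewrite mxE; case: split => j. Qed.

Lemma map_mact_on V N (P : V -> Prop) (f : V -> N) m n (a : 'M[S]_(m, n))
    (x : 'cV[V]_n) : is_sub P -> lin_on P f -> all_in P x ->
  map_mx f (a *v x) = a *v map_mx f x.
Proof.
move=> Ps fl Px; apply: colP0 => i; rewrite !mxE (lin_on_sum Ps fl); last first.
  by move=> k _; apply: subZ.
by apply: eq_bigr => k _; rewrite mxE (lin_onZ Ps fl).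
Qed.

Lemma map_mact V N (f : V -> N) m n (a : 'M[S]_(m, n)) (x : 'cV[V]_n) :
  is_lin f -> map_mx f (a *v x) = a *v map_mx f x.
Proof.
by move=> fl; apply: (@map_mact_on _ _ (@whole R V)) => //; apply: lin_onT.
Qed.

Lemma map_mxc T1 T2 T3 (f : T1 -> T2) (g : T2 -> T3) m n (x : 'M[T1]_(m, n)) :
  map_mx g (map_mx f x) = map_mx (fun t => g (f t)) x.
Proof. by apply/matrixP => i j; rewrite !mxE. Qed.

Lemma map_mx_eq T1 T2 (f g : T1 -> T2) m n (x : 'M[T1]_(m, n)) :
  (forall t, f t = g t) -> map_mx f x = map_mx g x.
Proof. by move=> E; apply/matrixP => i j; rewrite !mxE. Qed.

Lemma map_mx0_lin V N (f : V -> N) n : is_lin f -> map_mx f (0 : 'cV[V]_n) = 0.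
Proof. by move=> fl; apply: colP0 => i; rewrite !mxE lin0. Qed.

Lemma map_mxB_lin V N (f : V -> N) n (x y : 'cV[V]_n) : is_lin f ->
  map_mx f (x - y) = map_mx f x - map_mx f y.
Proof. by move=> fl; apply: colP0 => i; rewrite !mxE linB. Qed.

Lemma map_mxD_lin V N (f : V -> N) n (x y : 'cV[V]_n) : is_lin f ->
  map_mx f (x + y) = map_mx f x + map_mx f y.
Proof. by move=> fl; apply: colP0 => i; rewrite !mxE linD. Qed.

Lemma col_lift T1 T2 (Q : T1 -> T2 -> Prop) n (x : 'cV[T1]_n) :
  (forall i, exists y, Q (x i 0) y) -> exists y : 'cV[T2]_n, forall i, Q (x i 0) (y i 0).
Proof.
move=> /choice [g gP]; exists (\col_i g i) => i; rewrite mxE; exact: gP.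
Qed.

Definition rowspan V n (x : 'cV[V]_n) : V -> Prop :=
  fun v => exists c : 'rV[S]_n, v = (c *v x) 0 0.

Lemma is_sub_rowspan V n (x : 'cV[V]_n) : is_sub (rowspan x).
Proof.
split=> [|a _ _ [c ->] [d ->]]; first by exists 0; rewrite mact0l mxE.
by exists (a *: c + d); rewrite mactDl [RHS]mxE mactZl.
Qed.

Lemma mact_delta V n (x : 'cV[V]_n) i : (delta_mx 0 i *v x) (0 : 'I_1) 0 = x i 0.
Proof.
rewrite mactE (bigD1 i) //= big1 => [|j /negPf ne].
  by rewrite mxE !eqxx scale1r addr0.
by rewrite mxE eqxx ne scale0r.
Qed.

Lemma rowspan_in V n (x : 'cV[V]_n) i : rowspan x (x i 0).
Proof. by exists (delta_mx 0 i); rewrite mact_delta. Qed.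

Lemma all_in_rowspan V n (x : 'cV[V]_n) m (y : 'cV[V]_m) :
  all_in (rowspan x) y <-> exists a : 'M[S]_(m, n), y = a *v x.
Proof.
split=> [/choice [c cP]|[a ->]].
  exists (\matrix_(i, j) c i 0 j); apply: colP0 => i; rewrite cP !mactE.
  by apply: eq_bigr => j _; rewrite mxE.
by apply: all_in_mact; [exact: is_sub_rowspan | exact: rowspan_in].
Qed.

Lemma rowspan_sub V (P : V -> Prop) n (x : 'cV[V]_n) v :
  is_sub P -> all_in P x -> rowspan x v -> P v.
Proof. by move=> Ps Px [c ->]; apply: all_in_mact. Qed.

Lemma rowspan_mact V n (x : 'cV[V]_n) m (a : 'M[S]_(m, n)) v :
  rowspan (a *v x) v -> rowspan x v.
Proof. by move=> [c ->]; exists (c *m a); rewrite mactA. Qed.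

Lemma rowspan_colu V n m (x : 'cV[V]_n) (y : 'cV[V]_m) v :
  rowspan x v -> rowspan (col_mx x y) v.
Proof. by move=> [c ->]; exists (row_mx c 0); rewrite mact_row mact0l addr0. Qed.

Lemma rowspan_cold V n m (x : 'cV[V]_n) (y : 'cV[V]_m) v :
  rowspan y v -> rowspan (col_mx x y) v.
Proof. by move=> [c ->]; exists (row_mx 0 c); rewrite mact_row mact0l add0r. Qed.

End MatrixAction.

(** * Extensions *)

Section Extensions.
Variable R : pzRingType.
Local Notation S := (R^c).
Implicit Types M N B V : rmod R.

(** For a retraction r, the element [e - i (r e)] depends only on [p e]; applied to any
    set-theoretic section of p it therefore yields a linear one. *)
Lemma Ext1_zero_retract M N :
  (forall (E : rmod R) (i : N -> E) (p : E -> M),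
    is_lin i -> is_lin p -> injective i -> (forall a, exists e, p e = a) ->
    (forall e, p e = 0 <-> exists b, i b = e) ->
    exists r : E -> N, is_lin r /\ forall b, r (i b) = b) ->
  Ext1_zero M N.
Proof.
move=> H E i p il pl ii ps ex; have [r [rl rK]] := H E i p il pl ii ps ex.
have [s sP] := choice ps.
have key e e' : p e = p e' -> e - i (r e) = e' - i (r e').
  move=> pe; have [b bE] : exists b, i b = e - e' by apply/ex; rewrite linB // pe subrr.
  have -> : e = e' + i b by rewrite bE addrC subrK.
  by rewrite (linD rl) rK (linD il) opprD addrACA subrr addr0.
exists (fun a => s a - i (r (s a))); split=> [a x y|a]; last first.
  by rewrite linB // sP (_ : p (i _) = 0) ?subr0 //; apply/ex; exists (r (s a)).
rewrite (@key _ (a *: s x + s y)); last by rewrite pl !sP.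
by rewrite rl il opprD scalerBr addrACA.
Qed.

(* Pushout of the extension along [f]. *)
Lemma ext_extend (X Y A B : rmod R) (i : X -> Y) (p : Y -> A) (f : X -> B) :
  is_lin i -> is_lin p -> injective i -> (forall a, exists y, p y = a) ->
  (forall y, p y = 0 <-> exists x, i x = y) -> Ext1_zero A B -> is_lin f ->
  exists g : Y -> B, is_lin g /\ forall x, g (i x) = f x.
Proof.
move=> il pl ii ps ex EA fl.
pose V : rmod R := (B * Y)%type.
pose K (v : V) := exists x, v = (f x, - i x).
have Ks : is_sub K.
  split=> [|a _ _ [x ->] [y ->]]; first by exists 0; rewrite (lin0 fl) (lin0 il) oppr0.
  exists (a *: x + y); rewrite fl il opprD; congr pair.
  by rewrite /= scalerN.
pose E := SQ (quodata Ks); pose q : V -> E := sqpi (quodata Ks).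
have ql : is_lin q := quodata_lin Ks.
pose P (e : E) := p (sqval e).2.
have PK v : K v -> p v.2 = 0.
  by move=> [x ->] /=; apply/ex; exists (- x); rewrite (linN il).
have Pl : is_lin P.
  by apply: (@sqval_lin _ _ (quodata Ks) A (fun v => p v.2)) => // a x y _ _; rewrite pl.
have Pq v : P (q v) = p v.2.
  by apply: (@sqval_pi_fun _ _ (quodata Ks) A (fun v => p v.2)) => // a x y _ _; rewrite pl.
pose j (b : B) : E := q (b, 0).
have jl : is_lin j.
  move=> a x y; rewrite /j -ql; congr q; rewrite /=.
  by apply: injective_projections; rewrite //= scaler0 addr0.
have ji : injective j.
  move=> b b' /(@sqpi_inj _ _ (quodata Ks) _ _ I I) [x].
  move=> E1; have /= Eb := congr1 fst E1; have /= Ex := congr1 snd E1.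
  move: Ex; rewrite subrr => /esym/eqP; rewrite oppr_eq0 => /eqP Ex.
  have x0 : x = 0 by apply: ii; rewrite Ex lin0.
  by apply/eqP; rewrite -subr_eq0 Eb x0 lin0.
have Ps a : exists e, P e = a.
  by have [y yE] := ps a; exists (q (0, y)); rewrite Pq.
have Pex e : P e = 0 <-> exists b, j b = e.
  split=> [|[b <-]]; last by rewrite /j Pq /= lin0.
  rewrite -[e]sqvalK; case: (sqval e) => b y; rewrite Pq /= => /ex [x xE].
  exists (b + f x); apply: (@sqpi_eq _ _ (quodata Ks)) => //; exists x.
  by apply: injective_projections; rewrite /= ?xE ?sub0r // addrAC subrr add0r.
have [s [sl sP]] := EA E j P jl Pl ji Ps Pex.
(* The class of [(0, y)] and [s (p y)] have the same image in A, so they differ by an element of B,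
   which is the value of the extension at y. *)
have rex y : exists b, j b = q (0, y) - s (p y).
  by apply/Pex; rewrite linB // Pq sP subrr.
have [g gP] := choice rex; exists g; split=> [a x y|x].
  apply: ji; rewrite jl !gP pl sl scalerBr addrACA -opprD; congr (_ - _).
  rewrite -ql; congr q; apply: injective_projections => //=.
  by rewrite scaler0 addr0.
apply: ji; rewrite gP (_ : p (i x) = 0); last by apply/ex; exists x.
rewrite lin0 // subr0; apply: (@sqpi_eq _ _ (quodata Ks)) => //; exists (- x).
rewrite (linN il) (linN fl).
by apply: injective_projections; rewrite //= ?sub0r ?subr0 ?opprK.
Qed.

Lemma ext_extend_ker (Y A B : rmod R) (p : Y -> A) (f : Y -> B) :
  is_lin p -> (forall a, exists y, p y = a) -> Ext1_zero A B ->
  lin_on (fun y => p y = 0) f ->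
  exists g : Y -> B, is_lin g /\ forall y, p y = 0 -> g y = f y.
Proof.
move=> pl ps EA fl; pose K := SQ (subdata (is_sub_ker pl)).
have [||||g [gl gE]] := @ext_extend K Y A B (@sqval _ _ _) p (fun x => f (sqval x)) _ pl _ ps _ EA _.
- exact: subdata_val_lin.
- exact: sqval_inj.
- move=> y; split=> [py|[x <-]]; last exact: (sqval_in x).
  by exists (sqpi (subdata (is_sub_ker pl)) y); rewrite subdata_piK.
- apply: (@sqval_lin _ _ (subdata (is_sub_ker pl)) B f) => // v ->.
  exact: (lin_on0 (is_sub_ker pl) fl).
exists g; split=> // y py.
by have := gE (sqpi (subdata (is_sub_ker pl)) y); rewrite subdata_piK.
Qed.

(* Pullback of the extension along [g]. *)
Lemma ext_lift (E A B C : rmod R) (i : B -> E) (p : E -> A) (g : C -> A) :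
  is_lin i -> is_lin p -> injective i -> (forall a, exists y, p y = a) ->
  (forall e, p e = 0 <-> exists b, i b = e) -> Ext1_zero C B -> is_lin g ->
  exists s : C -> E, is_lin s /\ forall c, p (s c) = g c.
Proof.
move=> il pl ii ps ex EC gl.
pose V : rmod R := (E * C)%type.
pose P (v : V) := p v.1 = g v.2.
have Ps : is_sub P.
  split=> [|a x y]; rewrite /P /=; first by rewrite (lin0 pl) (lin0 gl).
  by move=> Px Py; rewrite pl gl Px Py.
pose W := SQ (subdata Ps).
have vl : is_lin (fun w : W => sqval w) := @subdata_val_lin _ _ _ Ps.
have Pi b : P (i b, 0).
  by rewrite /P /= (lin0 gl); apply/ex; exists b.
have [|||||s [sl sP]] := EC W (fun b => sqpi (subdata Ps) (i b, 0)) (fun w => (sqval w).2).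
- move=> a x y; apply: sqval_inj; rewrite vl !subdata_piK // il.
  by apply: injective_projections; rewrite //= scaler0 addr0.
- by move=> a x y; rewrite vl.
- by move=> x y /(congr1 (fun w => (sqval w).1)); rewrite !subdata_piK // => /ii.
- move=> c; have [e eE] := ps (g c).
  by exists (sqpi (subdata Ps) (e, c)); rewrite subdata_piK.
- move=> w; split=> [w0|[b <-]]; last by rewrite subdata_piK.
  have := sqval_in w; rewrite /= /P w0 (lin0 gl) => /ex [b bE]; exists b.
  apply: sqval_inj; rewrite (subdata_piK Ps (Pi b)).
  by apply: injective_projections => /=.
exists (fun c => (sqval (s c)).1); split=> [a x y|c]; first by rewrite sl vl.
by have := sqval_in (s c); rewrite /= /P sP.
Qed.

End Extensions.

(** * Direct limits of subquotients *)

Section LimitSubquotients.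
Variables (R : pzRingType) (V : rmod R) (I : Type) (le : I -> I -> Prop).
Variable d : I -> sqdata V.
Hypothesis led : directed le.
Hypothesis lePN : forall i j, le i j ->
  (forall v, sqP (d i) v -> sqP (d j) v) /\ (forall v, sqN (d i) v -> sqN (d j) v).

Definition sqtrans i j (q : SQ (d i)) : SQ (d j) := sqpi (d j) (sqval q).

Lemma sqtrans_lin i j : le i j -> is_lin (@sqtrans i j).
Proof.
move=> /lePN [leP leN]; apply: (@sqval_lin _ _ (d i) _ (sqpi (d j) : V -> SQ (d j))).
  by move=> a x y Px Py; apply: sqpi_lin; apply: leP.
by move=> v Nv; apply: sqpi_eq0; apply: leN.
Qed.

Lemma sqtrans_pi i j v : le i j -> sqP (d i) v ->
  sqtrans j (sqpi (d i) v) = sqpi (d j) v.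
Proof.
move=> /lePN [leP leN] Pv.
apply: (@sqval_pi_fun _ _ (d i) _ (sqpi (d j) : V -> SQ (d j))) => //.
  by move=> a x y Px Py; apply: sqpi_lin; apply: leP.
by move=> u Nu; apply: sqpi_eq0; apply: leN.
Qed.

Lemma sqtrans_system : direct_system le sqtrans.
Proof.
split=> //; split; first exact: sqtrans_lin.
split=> [i x|i j k ij jk x]; first exact: sqvalK.
rewrite /sqtrans -[RHS](sqtrans_pi jk) //.
by have [leP _] := lePN ij; apply: leP; apply: sqval_in.
Qed.

Variables (L : rmod R) (eps : V -> L).
Hypothesis eps_lin : forall i, lin_on (sqP (d i)) eps.
Hypothesis eps_onto : forall y, exists i v, sqP (d i) v /\ eps v = y.
Hypothesis eps_ker : forall i v, sqP (d i) v -> eps v = 0 -> exists j, sqN (d j) v.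
Hypothesis eps_N : forall i v, sqN (d i) v -> eps v = 0.

(** An element of L comes from some v at some stage, and two such v become congruent at a later
    stage; so the maps [h i] induce a well-defined map on L. *)
Lemma sqtrans_dirlim : is_dirlim le sqtrans (fun i (q : SQ (d i)) => eps (sqval q)).
Proof.
have [_ [lexx [letr leD]]] := led.
have el i : is_lin (fun q : SQ (d i) => eps (sqval q)).
  by apply: (@sqval_lin _ _ (d i)); [exact: eps_lin | exact: eps_N].
have epi i v : sqP (d i) v -> eps (sqval (sqpi (d i) v)) = eps v.
  by move=> Pv; apply: (@sqval_pi_fun _ _ (d i)) => // u; apply: eps_N.
split=> //; split=> [i j ij x|N h hl hc].
  by rewrite epi //; have [leP _] := lePN ij; apply: leP; apply: sqval_in.
have key i v j v' : sqP (d i) v -> sqP (d j) v' -> eps v = eps v' ->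
    h i (sqpi (d i) v) = h j (sqpi (d j) v').
  move=> Pv Pv' E; have [k [ik jk]] := leD i j.
  have Pkv := (lePN ik).1 _ Pv; have Pkv' := (lePN jk).1 _ Pv'.
  have [l Nl] : exists l, sqN (d l) (v - v').
    apply: (@eps_ker k); first by apply: (subB (sqP_sub (d k))).
    by rewrite (lin_onB (sqP_sub _) (@eps_lin k)) // E subrr.
  have [t [kt lt]] := leD k l.
  have it := letr _ _ _ ik kt; have jt := letr _ _ _ jk kt.
  rewrite -(hc _ _ it) -(hc _ _ jt) !sqtrans_pi //.
  congr (h t _); apply: sqpi_eq; [exact: (lePN kt).1 | exact: (lePN kt).1 |].
  exact: (lePN lt).2.
have hex y : exists z, forall i v, sqP (d i) v -> eps v = y -> h i (sqpi (d i) v) = z.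
  have [i [v [Pv vE]]] := eps_onto y; exists (h i (sqpi (d i) v)) => j v' Pv' vE'.
  by apply: key => //; rewrite vE vE'.
have [u uP] := choice hex; exists u.
have ug i x : u (eps (sqval x)) = h i x.
  by rewrite -(uP _ i (sqval x)) ?sqvalK //; apply: sqval_in.
split; last split => //.
  move=> a y y'; have [i [v [Pv <-]]] := eps_onto y; have [j [v' [Pv' <-]]] := eps_onto y'.
  have [k [ik jk]] := leD i j.
  have Pkv := (lePN ik).1 _ Pv; have Pkv' := (lePN jk).1 _ Pv'.
  rewrite -(@eps_lin k) // -(uP _ k (a *: v + v')) //; last exact: (sqP_sub (d k)).2.
  by rewrite sqpi_lin // hl -(uP _ k v) // -(uP _ k v').
move=> w wl wE y; have [i [v [Pv <-]]] := eps_onto y.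
by rewrite -(uP _ i v) // -wE epi.
Qed.

End LimitSubquotients.

(** * Direct sums and free modules *)

Section DirectSum.
Variables (R : pzRingType) (J : Type) (F : J -> rmod R).
Local Notation S := (R^c).
Local Notation cJ := {classic J}.

(** The alias [{classic J}] gives an arbitrary index type a decidable equality, so that finite
    supports can be covered by duplicate-free lists. *)
Definition covers (l : seq cJ) (f : dprod F) := forall j, f j <> 0 -> (j : cJ) \in l.
Definition fin_supp (f : dprod F) := exists l, uniq l /\ covers l f.

Lemma coversN l f j : covers l f -> (j : cJ) \notin l -> f j = 0.
Proof. by move=> cl nl; apply: contrapT => /cl; rewrite (negPf nl). Qed.

Lemma covers_sub l l' f : {subset l <= l'} -> covers l f -> covers l' f.
Proof. by move=> s cl j /cl /s. Qed.

Lemma covers_undup l f : covers l f -> covers (undup l) f.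
Proof. by apply: covers_sub => j; rewrite mem_undup. Qed.

Lemma covers_lin l a f g : covers l f -> covers l g -> covers l (a *: f + g).
Proof.
move=> cf cg j; apply: contra_notP => /negP nl.
by rewrite dprodE (coversN cf) // (coversN cg) // scaler0 addr0.
Qed.

Lemma common_cover f g : fin_supp f -> fin_supp g ->
  exists l, uniq l /\ covers l f /\ covers l g.
Proof.
move=> [l [_ cf]] [l' [_ cg]]; exists (undup (l ++ l')); split; first exact: undup_uniq.
by split; apply: covers_undup; [apply: covers_sub cf | apply: covers_sub cg];
  move=> j; rewrite mem_cat => ->; rewrite ?orbT.
Qed.

Lemma is_sub_fin_supp : is_sub fin_supp.
Proof.
split=> [|a f g fs gs]; first by exists [::]; split=> // j; rewrite dprod0.
have [l [ul [cf cg]]] := common_cover fs gs.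
by exists l; split=> //; apply: covers_lin.
Qed.

Let D := subdata is_sub_fin_supp.

Definition dsum : rmod R := SQ D.
Definition dinj j (x : F j) : dsum := sqpi D (dsingle x).

Lemma fin_supp_single j (x : F j) : fin_supp (dsingle x).
Proof.
exists [:: (j : cJ)]; split=> // j'; apply: contra_notP => /negP.
by rewrite inE => /eqP nj; apply: dsingle_neq => /esym.
Qed.

Lemma dinj_val j (x : F j) : sqval (dinj x) = dsingle x.
Proof. by rewrite subdata_piK //; apply: fin_supp_single. Qed.

Lemma dinj_lin j : is_lin (@dinj j).
Proof.
move=> a x y; apply: sqval_inj; rewrite subdata_val_lin !dinj_val.
exact: dsingle_lin.
Qed.

Lemma dprod_sum (K : Type) (r : seq K) (f : K -> dprod F) j :
  (\sum_(k <- r) f k) j = \sum_(k <- r) f k j.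
Proof. by elim: r => [|k r IH]; rewrite ?big_nil // !big_cons -IH. Qed.

Lemma dsum_expand (u : dsum) l : uniq l -> covers l (sqval u) ->
  u = \sum_(j <- l) dinj (sqval u j).
Proof.
move=> ul cl; apply: sqval_inj; rewrite (lin_sum (@subdata_val_lin _ _ _ is_sub_fin_supp)).
apply: dprod_ext => j; rewrite dprod_sum.
under eq_bigr do rewrite dinj_val.
have [jl|jl] := boolP ((j : cJ) \in l); last first.
  rewrite (coversN cl jl) big_seq big1 // => k kl; apply: dsingle_neq => kj.
  by rewrite -kj kl in jl.
rewrite (bigD1_seq (j : cJ)) //= dsingle_eq big1 ?addr0 // => k /eqP kj.
exact: dsingle_neq.
Qed.

Lemma covers_ex (u : dsum) : exists l, uniq l /\ covers l (sqval u).
Proof. exact: sqval_in u. Qed.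

Lemma dsum_eq (B : rmod R) (f g : dsum -> B) : is_lin f -> is_lin g ->
  (forall j (x : F j), f (dinj x) = g (dinj x)) -> forall u, f u = g u.
Proof.
move=> fl gl fg u; have [l [ul cl]] := covers_ex u.
by rewrite (dsum_expand ul cl) (lin_sum fl) (lin_sum gl); apply: eq_bigr.
Qed.

Lemma dsum_lift (B : rmod R) (h : forall j, F j -> B) : (forall j, is_lin (h j)) ->
  exists g : dsum -> B, is_lin g /\ forall j (x : F j), g (dinj x) = h j x.
Proof.
move=> hl.
(* The value at f will be a sum over a covering list; enlarging the list only adds zero terms, so
   the sum does not depend on it. *)
have sub_eq f l l' : uniq l -> uniq l' -> {subset l <= l'} -> covers l f ->
    \sum_(j <- l') h j (f j) = \sum_(j <- l) h j (f j).
  move=> ul ul' ll cf.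
  rewrite (bigID (mem l)) /= [X in _ + X]big1 ?addr0; last first.
    by move=> j nl; rewrite (coversN cf nl) (lin0 (hl j)).
  rewrite -big_filter; apply: perm_big; apply: uniq_perm => //; first exact: filter_uniq.
  by move=> j; rewrite mem_filter; case jl: (j \in l) => //=; apply: ll.
have all_eq f l l' : uniq l -> uniq l' -> covers l f -> covers l' f ->
    \sum_(j <- l) h j (f j) = \sum_(j <- l') h j (f j).
  move=> ul ul' cl cl'; have U := undup_uniq (l ++ l').
  rewrite -(sub_eq f l (undup (l ++ l'))) // -?(sub_eq f l' (undup (l ++ l'))) //;
    by move=> j jl; rewrite mem_undup mem_cat jl ?orbT.
have gex (u : dsum) : exists b, forall l, uniq l -> covers l (sqval u) ->
    \sum_(j <- l) h j (sqval u j) = b.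
  have [l [ul cl]] := covers_ex u; exists (\sum_(j <- l) h j (sqval u j)) => l' ul' cl'.
  exact: all_eq.
have [g gP] := choice gex; exists g; split=> [a u v|j x].
  have [l [ul [cu cv]]] := common_cover (sqval_in u) (sqval_in v).
  rewrite -(gP u l) // -(gP v l) // -(gP _ l) //; last first.
    by rewrite subdata_val_lin; apply: covers_lin.
  rewrite scaler_sumr -big_split; apply: eq_bigr => j _.
  by rewrite subdata_val_lin hl.
rewrite -(gP _ [:: (j : cJ)]) ?dinj_val //.
  by rewrite big_seq1 dsingle_eq.
move=> j'; apply: contra_notP => /negP.
by rewrite inE => /eqP nj; apply: dsingle_neq => /esym.
Qed.

Lemma Ext1_zero_dsum (B : rmod R) :
  (forall j, Ext1_zero (F j) B) -> Ext1_zero dsum B.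
Proof.
move=> EF E i p il pl ii ps ex.
have sex j := cid (ext_lift il pl ii ps ex (EF j) (@dinj_lin j)).
have [g [gl gE]] := @dsum_lift E (fun j => projT1 (sex j)) (fun j => (projT2 (sex j)).1); exists g; split=> // u.
apply: (@dsum_eq dsum (fun u => p (g u)) id) => //; first exact: is_lin_comp.
by move=> j x; rewrite gE (projT2 (sex j)).2.
Qed.

End DirectSum.

(** * Free modules *)

Section FreeModule.
Variables (R : pzRingType) (T : Type).
Local Notation S := (R^c).

Definition regmod : rmod R := S^o.
Definition freemod : rmod R := dsum (fun _ : T => regmod).
Definition fgen (t : T) : freemod := @dinj R T (fun _ => regmod) t (1 : S).

Lemma free_lift (B : rmod R) (th : T -> B) :
  exists h : freemod -> B, is_lin h /\ forall t, h (fgen t) = th t.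
Proof.
have [|g [gl gE]] := @dsum_lift R T (fun _ => regmod) B (fun t c => c *: th t).
  by move=> t a x y; rewrite scalerDl scalerA.
by exists g; split=> // t; rewrite gE scale1r.
Qed.

Definition fgens n (v : 'I_n -> T) : 'cV[freemod]_n := \col_i fgen (v i).

Lemma free_lift_inj (B : rmod R) n (v : 'I_n -> T) (z : 'cV[B]_n) : injective v ->
  exists h : freemod -> B, is_lin h /\ map_mx h (fgens v) = z.
Proof.
move=> vi; pose th t := match pselect (exists i, v i = t) with
  | left e => z (sval (cid e)) 0 | right _ => 0 end.
have [h [hl hE]] := free_lift th; exists h; split=> //; apply: colP0 => i.
rewrite !mxE hE /th; case: pselect => [e|[]]; last by exists i.
by case: cid => j /= /vi ->.
Qed.

(** The linear map that sends the j-th listed generator to 1 and the others to 0 reads off column j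
    of a coefficient matrix. *)
Lemma fgens_free n (v : 'I_n -> T) m (a b : 'M[S]_(m, n)) : injective v ->
  a *v fgens v = b *v fgens v -> a = b.
Proof.
move=> vi E; apply/matrixP => i j.
have [h [hl hE]] := @free_lift_inj regmod n v (\col_k (if k == j then 1 else 0 : S)) vi.
have coef (c : 'M[S]_(m, n)) : h ((c *v fgens v) i 0) = c i j.
  have -> : h ((c *v fgens v) i 0) = map_mx h (c *v fgens v) i 0 by rewrite [RHS]mxE.
  rewrite (map_mact _ _ hl) hE mactE (bigD1 j) //= big1 => [|k /negPf ne].
    by rewrite mxE eqxx addr0; apply: mulr1.
  by rewrite mxE ne scaler0.
by rewrite -coef E coef.
Qed.

Lemma free_coords m (x : 'cV[freemod]_m) :
  exists n (v : 'I_n -> T) (w : 'M[S]_(m, n)), injective v /\ x = w *v fgens v.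
Proof.
have [l lP] := choice (fun i => covers_ex (x i 0)).
pose L := undup (flatten [seq l i | i <- enum 'I_m]).
have uL : uniq L := undup_uniq _.
exists (size L), (fun k => tnth (in_tuple L) k : T),
  (\matrix_(i, k) (sqval (x i 0) (tnth (in_tuple L) k))).
split; first by move=> k k0 kk; apply: (elimT (tuple_uniqP (in_tuple L)) uL k k0 kk).
apply: colP0 => i; rewrite mactE.
have cL : covers L (sqval (x i 0)).
  apply: covers_undup; apply: covers_sub (lP i).2 => j jl.
  by apply/flatten_mapP; exists i => //; rewrite mem_enum.
rewrite {1}(dsum_expand uL cL) big_tnth; apply: eq_bigr => k _.
rewrite !mxE -(linZ (@dinj_lin _ _ (fun _ => regmod) _)); congr dinj.
by rewrite /GRing.scale /= mulr1.
Qed.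

End FreeModule.

Lemma free_eq (R : pzRingType) (T : Type) (B : rmod R) (f g : freemod R T -> B) :
  is_lin f -> is_lin g -> (forall t, f (fgen R t) = g (fgen R t)) -> forall u, f u = g u.
Proof.
move=> fl gl fg u.
have [n [v [w [_ uE]]]] := free_coords (\col_(i < 1) u).
have -> : u = (w *v fgens R v) 0 0 by rewrite -uE mxE.
rewrite mactE (lin_sum fl) (lin_sum gl); apply: eq_bigr => i _.
by rewrite mxE (linZ fl) (linZ gl) fg.
Qed.

Definition projective (R : pzRingType) (G : rmod R) :=
  forall (V N : rmod R) (q : V -> N) (f : G -> N), is_lin q ->
    (forall y, exists v, q v = y) -> is_lin f ->
    exists H : G -> V, is_lin H /\ forall g, q (H g) = f g.

Lemma free_projective (R : pzRingType) (T : Type) : projective (freemod R T).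
Proof.
move=> V N q f ql qs fl; have [s sP] := choice qs.
have [H [Hl HE]] := free_lift (fun t => s (f (fgen R t))); exists H; split=> //.
by apply: free_eq => //; [exact: is_lin_comp | move=> t; rewrite HE sP].
Qed.

Definition single (R : pzRingType) (V : rmod R) (v : V) : 'cV[V]_1 := const_mx v.

Lemma rowspan_single (R : pzRingType) (V : rmod R) (v : V) : rowspan (single v) v.
Proof. by have := rowspan_in (single v) 0; rewrite mxE. Qed.

Lemma directed_bound (J : Type) (le : J -> J -> Prop) n (c : 'I_n -> J) :
  directed le -> exists j, forall i, le (c i) j.
Proof.
move=> [[j0 _] [lexx [letr leD]]].
elim: n c => [|n IH] c; first by exists j0; case.
have [j jP] := IH (fun i => c (lift ord0 i)); have [k [jk ck]] := leD j (c ord0).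
exists k => i; case: (unliftP ord0 i) => [i' ->|-> //].
exact: letr (jP i') jk.
Qed.

Lemma descend (R : pzRingType) (G M B : rmod R) (p : G -> M) (h : G -> B) :
  is_lin p -> (forall y, exists g, p g = y) -> is_lin h ->
  (forall g, p g = 0 -> h g = 0) ->
  exists u : M -> B, is_lin u /\ forall g, u (p g) = h g.
Proof.
move=> pl ps hl hk; have [s sP] := choice ps.
have E g g' : p g = p g' -> h g = h g'.
  move=> pg; apply/eqP; rewrite -subr_eq0 -(linB hl) hk //.
  by rewrite (linB pl) pg subrr.
exists (fun y => h (s y)); split=> [a x y|g]; last by apply: E.
by rewrite -hl; apply: E; rewrite pl !sP.
Qed.

(** * Reduced products in the right-hand class of a cotorsion pair *)

Section MaskedProducts.
Variables (R : pzRingType) (J : Type) (F : J -> rmod R).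

Definition supp_in (W : J -> Prop) (f : dprod F) := forall j, ~ W j -> f j = 0.

Lemma is_sub_supp_in W : is_sub (supp_in W).
Proof.
by split=> // a f g fW gW j nW; rewrite dprodE fW // gW // scaler0 addr0.
Qed.

(* The functions supported in W modulo those vanishing on W', that is, the
   product over the intersection of W and W'. *)
Definition maskdata (W W' : J -> Prop) : sqdata (dprod F).
Proof.
refine (@SqData R _ (supp_in W)
  (fun f => supp_in W f /\ forall j, W' j -> f j = 0) (is_sub_supp_in W) _ _); last first.
  by move=> f [].
split=> [|a f g [fW f0] [gW g0]]; first by split=> //; apply: (is_sub_supp_in W).1.
split; first exact: (is_sub_supp_in W).2.
by move=> j Wj; rewrite dprodE f0 // g0 // scaler0 addr0.
Defined.

Variable le : J -> J -> Prop.
Hypothesis led : directed le.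

Definition ev_zero (f : dprod F) := exists i, forall j, le i j -> f j = 0.

Lemma is_sub_ev_zero : is_sub ev_zero.
Proof.
have [[i0 _] [lexx [letr leD]]] := led.
split=> [|a f g [i iP] [j jP]]; first by exists i0.
have [k [ik jk]] := leD i j; exists k => l kl.
rewrite dprodE iP ?jP ?scaler0 ?addr0 //; [exact: letr jk kl | exact: letr ik kl].
Qed.

End MaskedProducts.

Section CotorsionPair.
Variables (R : pzRingType) (A BB : mclass R).
Local Notation S := (R^c).
Hypothesis cot : cotorsion_pair A BB.
Hypothesis clB : closed_dirlim BB.

Lemma cot_Ext M N : A M -> BB N -> Ext1_zero M N.
Proof. by move=> AM /cot.2; apply. Qed.

(** Each coordinate in both W and W' extends separately to E, because [F j] is in BB; at all other
    coordinates the zero map serves. *)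
Lemma maskdata_BB (J : Type) (F : J -> rmod R) (W W' : J -> Prop) :
  (forall j, BB (F j)) -> BB (SQ (maskdata F W W')).
Proof.
move=> BF; apply/cot.2 => M AM; apply: Ext1_zero_retract => E i p il pl ii ps ex.
set D := maskdata F W W'.
have rex j : exists r : E -> F j, is_lin r /\
    ((W j /\ W' j) -> forall q, r (i q) = sqval q j) /\
    (~ (W j /\ W' j) -> forall e, r e = 0).
  have [Wj|nW] := pselect (W j /\ W' j); last first.
    by exists (fun _ => 0); split=> // a x y; rewrite scaler0 addr0.
  have cl : is_lin (fun q : SQ D => sqval q j).
    by apply: (@sqval_lin _ _ D (F j) (fun f => f j)) => // f [_]; apply; case: Wj.
  have [r [rl rE]] := ext_extend il pl ii ps ex (cot_Ext AM (BF j)) cl.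
  by exists r; split=> //; split=> // _ q; apply: rE.
pose r j := projT1 (cid (rex j)).
have rP j := projT2 (cid (rex j)); rewrite -/(r _) in rP.
pose h (e : E) : dprod F := fun j => r j e.
have hl : is_lin h by apply: is_lin_tuple => j; have [] := rP j.
have hW e : supp_in W (h e).
  by move=> j nW; have [_ [_ z]] := rP j; apply: z => -[].
exists (fun e => sqpi D (h e)); split=> [a x y|q].
  by rewrite hl (sqpi_lin (d := D) _ (hW x) (hW y)).
have Pq : supp_in W (sqval q) := sqval_in (d := D) q.
rewrite -[RHS]sqvalK; apply: (sqpi_eq (d := D) (hW _) Pq).
split; first exact: (subB (is_sub_supp_in F W)).
move=> j W'j; rewrite dprodB; apply/eqP; rewrite subr_eq0; apply/eqP.
have [Wj|nW] := pselect (W j); last by rewrite hW // Pq.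
by have [_ [e _]] := rP j; apply: e.
Qed.

Lemma dprod_BB (J : Type) (F : J -> rmod R) : (forall j, BB (F j)) -> BB (dprod F).
Proof.
move=> BF; apply/cot.2 => M AM; apply: Ext1_zero_retract => E i p il pl ii ps ex.
have rex j := ext_extend il pl ii ps ex (cot_Ext AM (BF j)) (@is_lin_proj _ _ F j).
pose r j := projT1 (cid (rex j)).
have rP j : is_lin (r j) /\ _ := projT2 (cid (rex j)).
exists (fun e => (fun j => r j e) : dprod F); split.
  by apply: is_lin_tuple => j; have [] := rP j.
by move=> b; apply: dprod_ext => j; have [_] := rP j; apply.
Qed.

Section ReducedProduct.
Variables (J : Type) (F : J -> rmod R) (le : J -> J -> Prop).
Hypothesis led : directed le.
Hypothesis BF : forall j, BB (F j).

Lemma ev_zero_BB : BB (SQ (subdata (is_sub_ev_zero F led))).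
Proof.
have [_ [lexx [letr leD]]] := led.
(* Stage i consists of the functions vanishing at every j above i. It is a product of some of the
   [F j], and the directed union of the stages is the module of eventually zero functions. *)
pose d i := maskdata F (fun j => ~ le i j) (fun _ => True).
pose eps := sqpi (subdata (is_sub_ev_zero F led)).
have Pev i v : sqP (d i) v -> ev_zero le v.
  by move=> Pv; exists i => j ij; apply: Pv.
have lePN i j : le i j ->
  (forall v, sqP (d i) v -> sqP (d j) v) /\ (forall v, sqN (d i) v -> sqN (d j) v).
  move=> ij; have leP v : sqP (d i) v -> sqP (d j) v.
    by move=> Pv k nn; apply: Pv => nik; apply: nn => jk; apply: nik; apply: letr jk.
  by split=> // v [Pv v0]; split=> //; apply: leP.
apply: (clB (sqtrans_system led lePN) _ (sqtrans_dirlim led lePN (eps := eps : _ -> SQ _) _ _ _ _)).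
- by move=> i; apply: maskdata_BB.
- by move=> i a x y Px Py; apply: (sqpi_lin (d := subdata _)); apply: Pev; eauto.
- move=> y; have [i iP] := sqval_in y; exists i, (sqval y); rewrite /eps sqvalK.
  by split=> // j /contrapT /iP.
- move=> i v Pv /(@sqpi_ker _ _ (subdata _) _ (Pev _ _ Pv)) /= ->; exists i.
  exact: (sub0 (sqN_sub (d i))).
- move=> i v [_ v0]; apply: (sqpi_eq0 (d := subdata _)).
  by apply: dprod_ext => j; apply: v0.
Qed.

Lemma reduced_BB : BB (SQ (quodata (is_sub_ev_zero F led))).
Proof.
have [[i0 _] [lexx [letr leD]]] := led.
(* Stage i is the product of the [F j] with j above i, and the transition maps are restrictions; two
   functions become equal in the limit exactly when they agree at some stage. *)
pose d i := maskdata F (fun _ => True) (fun j => le i j).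
pose eps := sqpi (quodata (is_sub_ev_zero F led)).
have PT i v : sqP (d i) v by move=> j; case.
have lePN i j : le i j ->
  (forall v, sqP (d i) v -> sqP (d j) v) /\ (forall v, sqN (d i) v -> sqN (d j) v).
  move=> ij; split=> [v _|v [_ v0]]; first exact: PT.
  by split=> [|k jk]; [exact: PT | apply: v0; apply: letr jk].
apply: (clB (sqtrans_system led lePN) _ (sqtrans_dirlim led lePN (eps := eps : _ -> SQ _) _ _ _ _)).
- by move=> i; apply: maskdata_BB.
- by move=> i a x y _ _; apply: (quodata_lin (is_sub_ev_zero F led)).
- by move=> y; exists i0, (sqval y); rewrite /eps sqvalK.
- move=> i v Pv /(@sqpi_ker _ _ (quodata _) v I) [j jP]; exists j.
  by split=> //; apply: PT.
- move=> i v [_ v0]; apply: (sqpi_eq0 (d := quodata _)).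
  by exists i.
Qed.

End ReducedProduct.

(** * Finitary approximations of modules in the left-hand class *)

Section Presentation.
Variables (G M : rmod R) (p : G -> M).
Hypotheses (pl : is_lin p) (ps : forall y, exists g, p g = y) (AM : A M).

Let rel := {kap : {k & 'cV[G]_k} | map_mx p (projT2 kap) = 0}.
Let rk (j : rel) : nat := projT1 (sval j).
Let kap (j : rel) : 'cV[G]_(rk j) := projT2 (sval j).
Let mkrel k (x : 'cV[G]_k) (x0 : map_mx p x = 0) : rel :=
  exist _ (existT _ k x) x0.
(** A given element of the kernel of p lies in the span of every sufficiently large index, so
    statements about finitely many kernel elements hold eventually. *)
Let le (i j : rel) := forall v, rowspan (kap i) v -> rowspan (kap j) v.

Let led : directed le.
Proof.
split.
  have x0 : map_mx p (0 : 'cV[G]_0) = 0 by apply: colP0 => -[].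
  by exists (mkrel x0).
split=> [i v //|]; split=> [i j k ij jk v /ij/jk //|i j].
have x0 : map_mx p (col_mx (kap i) (kap j)) = 0.
  by rewrite map_col_mx (svalP i) (svalP j) col_mx0.
by exists (mkrel x0); split=> v; [exact: rowspan_colu | exact: rowspan_cold].
Qed.

Let kill1 g : p g = 0 -> map_mx p (single g) = 0.
Proof. by move=> pg; apply: colP0 => i; rewrite !mxE pg. Qed.

(* If no finite set of relations sufficed, the counterexamples would give a map
   from M to their reduced product over all finite sets of relations, which
   lifts to the product because the eventually zero functions form a module
   in BB. *)
Lemma approx_hom m (x : 'cV[G]_m) :
  exists k (ka : 'cV[G]_k), map_mx p ka = 0 /\
    forall B, BB B -> forall h : G -> B, is_lin h -> map_mx h ka = 0 ->
    exists h' : G -> B, [/\ is_lin h', forall g, p g = 0 -> h' g = 0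
                          & map_mx h' x = map_mx h x].
Proof.
apply: contrapT => nex.
have cex (j : rel) : exists (B : rmod R) (h : G -> B), [/\ BB B, is_lin h, map_mx h (kap j) = 0 &
    ~ exists h' : G -> B, [/\ is_lin h', forall g, p g = 0 -> h' g = 0
                          & map_mx h' x = map_mx h x]].
  apply: contrapT => nB; apply: nex; exists (rk j), (kap j); split; first exact: (svalP j).
  move=> B BBB h hl hk; apply: contrapT => nh; apply: nB; exists B, h; split=> //.
pose F j := projT1 (cid (cex j)).
pose h j : G -> F j := projT1 (cid (projT2 (cid (cex j)))).
have hP j : [/\ BB (F j), is_lin (h j), map_mx (h j) (kap j) = 0 & _] :=
  projT2 (cid (projT2 (cid (cex j)))).
pose gam (g : G) : dprod F := fun j => h j g.
have gaml : is_lin gam by apply: is_lin_tuple => j; have [] := hP j.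
(* Every j above the one-element tuple g has [h j g = 0]. Thus gam maps the kernel of p to the
   eventually zero functions, a module in BB, and this map extends to a map [del] on G. *)
have gamK g : p g = 0 -> ev_zero le (gam g).
  move=> pg; exists (mkrel (kill1 pg)) => j /(_ g (rowspan_single g)) [c ->].
  have [_ hl hk _] := hP j.
  have -> : gam ((c *v kap j) 0 0) j = map_mx (h j) (c *v kap j) 0 0 by rewrite [RHS]mxE.
  by rewrite (map_mact _ _ hl) hk mact0r mxE.
pose D := subdata (is_sub_ev_zero F led).
have [||del [dell delE]] := @ext_extend_ker R G M (SQ D) p (fun g => sqpi D (gam g)) pl ps.
- by apply: cot_Ext => //; apply: ev_zero_BB => j; have [] := hP j.
- by move=> a g g' pg pg'; rewrite gaml (sqpi_lin (d := D)) //; apply: gamK.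
(* At some j all [del (x i 0)] have become zero. There the difference of [h j] and the j-th
   coordinate of [del] kills the kernel of p and still agrees with [h j] on x. *)
have [b bP] := choice (fun i => sqval_in (del (x i 0))).
have [j jP] := directed_bound b led.
have [_ hl _] := hP j; apply.
exists (fun g => h j g - sqval (del g) j); split.
- apply: is_lin_sub => // a g g'; rewrite dell.
  by rewrite (subdata_val_lin (Ps := is_sub_ev_zero F led)).
- move=> g pg; rewrite delE // subdata_piK; last exact: gamK.
  by rewrite subrr.
- by apply: colP0 => i; rewrite !mxE (bP i j (jP i)) subr0.
Qed.

(** Otherwise each finite set j of relations has a counterexample, which is a map on the span of
    [ka j] only. Together they form a map from the kernel of p to the reduced product. It extends to
    G and, G being projective, lifts to the product; for large j the lift agrees with the j-th
    counterexample on sig. *)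
Lemma approx_ext m (sig : 'cV[G]_m) : projective G -> map_mx p sig = 0 ->
  exists k (ka : 'cV[G]_k) (e : 'M[S]_(m, k)), [/\ map_mx p ka = 0, sig = e *v ka &
    forall B, BB B -> forall be : 'cV[B]_k,
      (forall d : 'rV[S]_k, d *v ka = 0 -> d *v be = 0) ->
      exists ga : G -> B, is_lin ga /\ map_mx ga sig = e *v be].
Proof.
move=> prG psig; apply: contrapT => nex.
(* Appending sig to the relations makes it recoverable by the block matrix [e j], whatever j is. *)
pose ka (j : rel) := col_mx (kap j) sig.
pose e j : 'M[S]_(m, rk j + m) := row_mx 0 1%:M.
have eka j : sig = e j *v ka j by rewrite mact_row mact0l mact1 add0r.
have cex (j : rel) : exists (B : rmod R) (be : 'cV[B]_(rk j + m)), [/\ BB B,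
    forall d : 'rV[S]_(rk j + m), d *v ka j = 0 -> d *v be = 0 &
    ~ exists ga : G -> B, is_lin ga /\ map_mx ga sig = e j *v be].
  apply: contrapT => nB; apply: nex; exists _, (ka j), (e j); split.
  - by rewrite map_col_mx (svalP j) psig col_mx0.
  - exact: eka.
  - by move=> B BBB be bc; apply: contrapT => nh; apply: nB; exists B, be.
pose F j := projT1 (cid (cex j)).
pose be j : 'cV[F j]_(rk j + m) := projT1 (cid (projT2 (cid (cex j)))).
have beP j : [/\ BB (F j), forall d : 'rV[S]_(rk j + m), d *v ka j = 0 -> d *v be j = 0 & _] :=
  projT2 (cid (projT2 (cid (cex j)))).
(* Consistency of [be j] makes it a function on the span of [ka j]; elements outside the span are
   sent to 0. *)
have bex j : exists b : G -> F j, forall d : 'rV[S]_(rk j + m),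
    b ((d *v ka j) 0 0) = (d *v be j) 0 0.
  have [_ bc _] := beP j.
  have gex g : exists y, forall d : 'rV[S]_(rk j + m), (d *v ka j) 0 0 = g -> (d *v be j) 0 0 = y.
    have [[d0 d0E]|nd] := pselect (exists d : 'rV[S]_(rk j + m), (d *v ka j) 0 0 = g); last first.
      by exists 0 => d dE; case: nd; exists d.
    exists ((d0 *v be j) 0 0) => d dE; apply/eqP; rewrite -subr_eq0.
    have -> : (d *v be j) 0 0 - (d0 *v be j) 0 0 = ((d - d0) *v be j) 0 0.
      by rewrite mactBl colB.
    rewrite bc ?mxE //; apply: colP0 => i; rewrite ord1 mactBl.
    by rewrite colB dE d0E subrr mxE.
  by have [b bP] := choice gex; exists b => d; rewrite -(bP _ d).
pose b j : G -> F j := projT1 (cid (bex j)).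
have bP j : forall d, b j ((d *v ka j) 0 0) = (d *v be j) 0 0 := projT2 (cid (bex j)).
have bl j : lin_on (rowspan (ka j)) (b j).
  move=> a _ _ [c ->] [d ->]; rewrite !bP.
  have E (V : rmod R) (y : 'cV[V]_(rk j + m)) :
      a *: (c *v y) 0 0 + (d *v y) 0 0 = ((a *: c + d) *v y) 0 0.
    by rewrite mactDl colD mactZl.
  by rewrite !E bP.
pose D := quodata (is_sub_ev_zero F led).
pose f (g : G) : SQ D := sqpi D ((fun j => b j g) : dprod F).
(* Each [b j] is linear only on its own span, but for large j this span contains any two given
   elements of the kernel, which suffices modulo eventually zero functions. *)
have fl : lin_on (fun g => p g = 0) f.
  move=> a g g' pg pg'; rewrite /f -(quodata_lin (is_sub_ev_zero F led)).
  apply: (sqpi_eq (d := D)) => //.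
  have x0 : map_mx p (col_mx (single g) (single g')) = 0.
    by rewrite map_col_mx; apply: colP0 => i; rewrite mxE; case: split => k; rewrite !mxE.
  exists (mkrel x0) => j jle; rewrite dprodB dprodE.
  have jin u : rowspan (col_mx (single g) (single g')) u -> rowspan (ka j) u.
    by move=> /jle; apply: rowspan_colu.
  rewrite bl ?subrr //; apply: jin.
    exact/rowspan_colu/rowspan_single.
  exact/rowspan_cold/rowspan_single.
have [|Ga [Gal GaE]] := ext_extend_ker pl ps _ fl.
  by apply: cot_Ext => //; apply: reduced_BB => j; have [] := beP j.
have [|H [Hl HG]] := prG _ _ (sqpi D : dprod F -> SQ D) Ga (quodata_lin (is_sub_ev_zero F led)) _ Gal.
  by move=> y; exists (sqval y); rewrite sqvalK.
have ev i : ev_zero le (H (sig i 0) - ((fun j => b j (sig i 0)) : dprod F)).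
  apply: (sqpi_inj (d := D)) => //; rewrite HG GaE //.
  by have := congr1 (fun y : 'cV[M]_m => y i 0) psig; rewrite !mxE.
have [c cP] := choice ev; have [j jP] := directed_bound c led.
have [_ _] := beP j; apply; exists (fun g => H g j); split.
  by move=> a u v; rewrite Hl.
apply: colP0 => i; rewrite mxE.
have := cP i j (jP i); rewrite dprodB => /eqP; rewrite subr_eq0 => /eqP ->.
have -> : sig i 0 = ((row i (e j)) *v ka j) 0 0.
  by rewrite {1}(eka j) !mactE; apply: eq_bigr => l _; rewrite [in RHS]mxE.
by rewrite bP !mactE; apply: eq_bigr => l _; rewrite [in LHS]mxE.
Qed.

End Presentation.

End CotorsionPair.

(** * Finitary conditions: killing extensions and dominating pp-types *)

Section FinitaryConditions.
Variables (R : pzRingType) (BB : mclass R).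
Local Notation S := (R^c).
Implicit Types M N B : rmod R.

(* The pp-formula "exists z, b = w z and r z = 0": maps to B from the module
   presented by r, evaluated at the tuple w of its elements. *)
Definition sat B a n k (w : 'M[S]_(a, n)) (r : 'M[S]_(k, n)) (b : 'cV[B]_a) :=
  exists z : 'cV[B]_n, w *v z = b /\ r *v z = 0.

(* [be] comes from a map to B defined on the row space of r. *)
Definition consistent B n k (r : 'M[S]_(k, n)) (be : 'cV[B]_k) :=
  forall d : 'rV[S]_k, d *m r = 0 -> d *v be = 0.

(* With F, F' presented by s, r and F -> F' given by s w = e r, this says that
   Ext^1(F', B) -> Ext^1(F, B) is zero for B in BB. *)
Definition kills_ext a m n k (s : 'M[S]_(m, a)) (r : 'M[S]_(k, n)) (e : 'M[S]_(m, k)) :=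
  forall B, BB B -> forall be : 'cV[B]_k, consistent r be ->
    exists ga : 'cV[B]_a, s *v ga = e *v be.

(* In modules from BB, the formula (w, r) implies the whole pp-type of x in M. *)
Definition dominates M a n k (x : 'cV[M]_a) (w : 'M[S]_(a, n)) (r : 'M[S]_(k, n)) :=
  forall B, BB B -> forall b : 'cV[B]_a, sat w r b ->
    forall n' k' (w' : 'M[S]_(a, n')) (r' : 'M[S]_(k', n')), sat w' r' x -> sat w' r' b.

(** Condition (E): s presents F, the tuple x is a map from F to M, and w is the matrix of F ->
    F'. *)
Definition ext_approximable M := forall a m (x : 'cV[M]_a) (s : 'M[S]_(m, a)),
  s *v x = 0 -> exists n k (w : 'M[S]_(a, n)) (r : 'M[S]_(k, n)) (e : 'M[S]_(m, k))
    (z : 'cV[M]_n), [/\ w *v z = x, r *v z = 0, s *m w = e *m r & kills_ext s r e].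

(** Condition (S), with one formula for all modules of BB. *)
Definition pp_dominated M := forall a (x : 'cV[M]_a),
  exists n k (w : 'M[S]_(a, n)) (r : 'M[S]_(k, n)) (z : 'cV[M]_n),
    [/\ w *v z = x, r *v z = 0 & dominates x w r].

Lemma sat_map M N (f : M -> N) a n k (w : 'M[S]_(a, n)) (r : 'M[S]_(k, n)) x :
  is_lin f -> sat w r x -> sat w r (map_mx f x).
Proof.
move=> fl [z [<- rz]]; exists (map_mx f z); rewrite -!map_mact // rz.
by split=> //; apply: map_mx0_lin.
Qed.

(** The formula (w, r) at x is a single linear system, with w stacked on r as matrix and (x, 0) as
    right-hand side; purity brings a solution from M to N. *)
Lemma pure_mono_sat N M (e : N -> M) a n k (w : 'M[S]_(a, n)) (r : 'M[S]_(k, n)) x :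
  pure_mono e -> sat w r (map_mx e x) -> sat w r x.
Proof.
move=> [el [_ pe]] [z [wz rz]].
have [|y yE] := pe _ _ (fun i j => col_mx w r i j) (fun i => col_mx x (0 : 'cV[N]_k) i 0)
  (fun j => z j 0).
  move=> i; have := congr1 (fun c : 'cV[M]__ => c i 0) (mact_col w r z).
  rewrite mactE => ->; rewrite wz rz.
  by rewrite !mxE; case: split => l; rewrite !mxE // lin0.
pose zy : 'cV[N]_n := \col_j y j; exists zy.
have : col_mx w r *v zy = col_mx x 0.
  by apply: colP0 => i; rewrite mactE -yE; apply: eq_bigr => j _; rewrite [zy _ _]mxE.
by rewrite mact_col => /eq_col_mx.
Qed.

Lemma pp_dominated_pure N M (e : N -> M) : pure_mono e -> pp_dominated M -> pp_dominated N.
Proof.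
move=> pe pM a x; have el := pe.1.
have [n [k [w [r [z [wz rz dz]]]]]] := pM a (map_mx e x).
have [|y [wy ry]] := @pure_mono_sat N M e a n k w r x pe; first by exists z.
exists n, k, w, r, y; split=> // B BBB b sb n' k' w' r' sx.
by apply: (dz B BBB b sb); apply: sat_map.
Qed.

(** The predicate [kills_ext] speaks of matrices only, so just the witness z has to be brought from
    M to N. *)
Lemma ext_approximable_pure N M (e : N -> M) :
  pure_mono e -> ext_approximable M -> ext_approximable N.
Proof.
move=> pe pM a m x s sx; have el := pe.1.
have [|n [k [w [r [f [z [wz rz swr kz]]]]]]] := pM a m (map_mx e x) s.
  by rewrite -map_mact // sx; apply: map_mx0_lin.
have [|y [wy ry]] := @pure_mono_sat N M e a n k w r x pe; first by exists z.
by exists n, k, w, r, f, y.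
Qed.

(** * The module presented by a matrix *)

Section FinPres.
Variables (a m : nat) (s : 'M[S]_(m, a)).

Definition relspan (c : 'rV[S]_a) := exists d : 'rV[S]_m, c = d *m s.

Lemma is_sub_relspan : @is_sub R 'rV[S]_a relspan.
Proof.
split=> [|b _ _ [c ->] [d ->]]; first by exists 0; rewrite mul0mx.
by exists (b *: c + d); rewrite mulmxDl scalemxAl.
Qed.

Definition finpres : rmod R := SQ (quodata is_sub_relspan).
Definition fppi : 'rV[S]_a -> finpres := sqpi (quodata is_sub_relspan).

Lemma fppi_lin : @is_lin R 'rV[S]_a finpres fppi.
Proof. exact: quodata_lin. Qed.

Definition fpgen : 'cV[finpres]_a := \col_i fppi (delta_mx 0 i).

Lemma fppiE c : fppi c = (c *v fpgen) 0 0.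
Proof.
rewrite {1}[c]row_sum_delta (lin_sum fppi_lin) mactE; apply: eq_bigr => i _.
by rewrite (linZ fppi_lin) mxE.
Qed.

Lemma fpgen_rel : s *v fpgen = 0.
Proof.
apply: colP0 => i; rewrite [RHS]mxE.
have -> : (s *v fpgen) i 0 = fppi (row i s).
  by rewrite fppiE !mactE; apply: eq_bigr => j _; rewrite [row i s _ _]mxE.
apply: (sqpi_eq0 (d := quodata is_sub_relspan)).
by exists (delta_mx 0 i); rewrite -rowE.
Qed.

Lemma fppi_onto y : exists c, fppi c = y.
Proof. by exists (sqval y); apply: sqvalK. Qed.

Lemma finpres_fin : fin_presented finpres.
Proof.
exists a, m, (fun i => fpgen i 0), (fun k i => s k i); split=> [x|].
  have [c <-] := fppi_onto x; exists (fun i => c 0 i).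
  by rewrite fppiE mactE.
split=> [k|c c0].
  by have := congr1 (fun y : 'cV[finpres]_m => y k 0) fpgen_rel; rewrite mactE mxE.
have : fppi (\row_i c i) = 0.
  by rewrite fppiE mactE -[RHS]c0; apply: eq_bigr => i _; rewrite mxE.
move=> /(@sqpi_ker _ _ (quodata is_sub_relspan) _ I) [d dE].
exists (fun k => d 0 k) => i; have := congr1 (fun y : 'rV[S]_a => y 0 i) dE.
by rewrite !mxE.
Qed.

Lemma finpres_lift B (b : 'cV[B]_a) : s *v b = 0 ->
  exists h : finpres -> B, is_lin h /\ map_mx h fpgen = b.
Proof.
move=> sb.
have bl : @is_lin R 'rV[S]_a B (fun c => (c *v b) 0 0).
  by move=> c x y; rewrite mactDl colD mactZl.
have bN (v : 'rV[S]_a) : relspan v -> (v *v b) 0 0 = 0.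
  by move=> [d ->]; rewrite mactA sb mact0r mxE.
exists (fun q => (sqval q *v b) 0 0); split.
  by apply: (@sqval_lin _ _ (quodata is_sub_relspan) B (fun c => (c *v b) 0 0)) => //; apply: lin_onT.
apply: colP0 => i; rewrite [LHS]mxE [fpgen _ _]mxE /fppi.
rewrite (@sqval_pi_fun _ _ (quodata is_sub_relspan) B (fun c => (c *v b) 0 0)) //.
exact: mact_delta.
Qed.

End FinPres.

(** The solution x is a map from the module presented by s; lifting that map along p lifts x
    together with its relations. *)
Lemma pure_epi_lift N M (p : N -> M) a m (x : 'cV[M]_a) (s : 'M[S]_(m, a)) :
  pure_epi p -> s *v x = 0 -> exists z : 'cV[N]_a, map_mx p z = x /\ s *v z = 0.
Proof.
move=> [pl [_ pp]] sx; have [phi [phil phiE]] := finpres_lift sx.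
have [psi [psil psiE]] := pp _ phi (finpres_fin s) phil.
exists (map_mx psi (fpgen s)); split; last by rewrite -map_mact // fpgen_rel map_mx0_lin.
by rewrite map_mxc -phiE; apply: map_mx_eq.
Qed.

Lemma ext_approximable_pure_epi N M (p : N -> M) :
  pure_epi p -> ext_approximable N -> ext_approximable M.
Proof.
move=> pe eN a m x s sx; have pl := pe.1.
have [y [yE sy]] := pure_epi_lift pe sx.
have [n [k [w [r [e [z [wz rz swr kz]]]]]]] := eN a m y s sy.
exists n, k, w, r, e, (map_mx p z); split=> //; first by rewrite -map_mact // wz.
by rewrite -map_mact // rz map_mx0_lin.
Qed.

End FinitaryConditions.

(** * The approximations of modules in A in matrix form *)

Section CotorsionPairApprox.
Variables (R : pzRingType) (A BB : mclass R).
Local Notation S := (R^c).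
Hypothesis cot : cotorsion_pair A BB.
Hypothesis clB : closed_dirlim BB.

Lemma free_cover (M : rmod R) : exists p : freemod R M -> M,
  [/\ is_lin p, (forall y, exists g, p g = y) & forall t, p (fgen R t) = t].
Proof.
have [p [pl pE]] := @free_lift R M M id; exists p; split=> //.
by move=> y; exists (fgen R y).
Qed.

Lemma cot_ext_approximable M : A M -> ext_approximable BB M.
Proof.
move=> AM a m x s sx; have [p [pl ps pE]] := free_cover M.
pose g : 'cV[freemod R M]_a := map_mx (@fgen R M) x.
have pg : map_mx p g = x by apply: colP0 => i; rewrite !mxE pE.
have psg : map_mx p (s *v g) = 0 by rewrite map_mact // pg.
have [k [ka [e [pka sE kE]]]] :=
  approx_ext cot clB pl ps AM (@free_projective R M) psg.
(* The same finitely many basis elements express g and ka; their coefficients are w and r.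
   Independence of the basis turns equations in the free module into equations of matrices. *)
have [n [v [wr [vi vE]]]] := free_coords (col_mx g ka).
have [gE kaE] : g = usubmx wr *v fgens R v /\ ka = dsubmx wr *v fgens R v.
  by move: vE; rewrite -{1}[wr]vsubmxK mact_col => /eq_col_mx.
set w := usubmx wr in gE *; set r := dsubmx wr in kaE *.
exists n, k, w, r, e, (map_mx p (fgens R v)).
rewrite -!map_mact // -gE -kaE pg pka; split=> //.
  by apply: (fgens_free vi); rewrite !mactA -gE -kaE.
move=> B BBB be bc; have [|ga [gal gaE]] := kE B BBB be.
  move=> d dka; apply: bc; apply: (fgens_free vi).
  by rewrite mactA -kaE dka mact0l.
by exists (map_mx ga g); rewrite -map_mact.
Qed.

(** This is stronger than domination: the tuples satisfying (w, r) are values at x of maps defined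
    on all of M, and such maps preserve every pp-formula. *)
Lemma cot_hom_approximable (M : rmod R) : A M -> forall a (x : 'cV[M]_a),
  exists n k (w : 'M[S]_(a, n)) (r : 'M[S]_(k, n)) (z : 'cV[M]_n),
    [/\ w *v z = x, r *v z = 0 & forall B, BB B -> forall b : 'cV[B]_a, sat w r b ->
      exists h : M -> B, is_lin h /\ map_mx h x = b].
Proof.
move=> AM a x; have [p [pl ps pE]] := free_cover M.
pose g : 'cV[freemod R M]_a := map_mx (@fgen R M) x.
have pg : map_mx p g = x by apply: colP0 => i; rewrite !mxE pE.
have [k [ka [pka kaP]]] := approx_hom cot clB pl ps AM g.
have [n [v [wr [vi vE]]]] := free_coords (col_mx g ka).
have [gE kaE] : g = usubmx wr *v fgens R v /\ ka = dsubmx wr *v fgens R v.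
  by move: vE; rewrite -{1}[wr]vsubmxK mact_col => /eq_col_mx.
set w := usubmx wr in gE *; set r := dsubmx wr in kaE *.
exists n, k, w, r, (map_mx p (fgens R v)).
rewrite -!map_mact // -gE -kaE pg pka; split=> // B BBB b [z [wz rz]].
have [h [hl hE]] := free_lift_inj z vi.
have [|h' [hl' hk' hx']] := kaP B BBB h hl; first by rewrite kaE map_mact // hE.
have [u [ul uE]] := descend pl ps hl' hk'.
exists u; split=> //; rewrite -pg map_mxc.
rewrite (map_mx_eq _ (g := h')) // hx' gE map_mact // hE //.
Qed.

End CotorsionPairApprox.

(** * Stationarity in terms of pp-types *)

Section DirectLimits.
Variables (R : pzRingType) (I : Type) (le : I -> I -> Prop) (F : I -> rmod R).
Variables (f : forall i j, F i -> F j) (M : rmod R) (g : forall i, F i -> M).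
Local Notation S := (R^c).
Hypotheses (sys : direct_system le f) (lim : is_dirlim le f g).

(** The zero map and the projection of M onto its quotient by the union of the images agree on every
    [F i], hence are equal by the uniqueness in the universal property. *)
Lemma dirlim_onto y : exists i x, @g i x = y.
Proof.
have [[[i0 _] [lexx [letr leD]]] [fl _]] := sys.
have [gl [gc gu]] := lim.
pose P y := exists i x, @g i x = y.
have Ps : is_sub P.
  split=> [|a _ _ [i [x <-]] [j [x' <-]]]; first by exists i0, 0; apply: lin0.
  have [k [ik jk]] := leD i j; exists k, (a *: f k x + f k x').
  by rewrite gl !gc.
have [||u [_ [_ uu]]] := gu (SQ (quodata Ps)) (fun i x => 0).
- by move=> i a x x'; rewrite scaler0 addr0.
- by [].
suff : sqpi (quodata Ps) y = 0 :> SQ (quodata Ps) by move=> /(@sqpi_ker _ _ (quodata Ps) _ Logic.I).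
rewrite (uu (sqpi (quodata Ps) : M -> SQ _)).
- by rewrite -(uu (fun _ => 0)) // => a x x'; rewrite scaler0 addr0.
- exact: quodata_lin.
- by move=> i x; apply: (sqpi_eq0 (d := quodata Ps)); exists i, x.
Qed.

(** The universal property is applied to the reduced product of the [F j], to which x is sent as the
    family of its images [f i j x]; the class of this family is zero only if the images are
    eventually zero. *)
Lemma dirlim_ker i (x : F i) : g x = 0 -> exists j, le i j /\ f j x = 0.
Proof.
have [led [fl [fid fcomp]]] := sys; have [_ [lexx [letr leD]]] := led.
have [gl [gc gu]] := lim.
pose D := quodata (is_sub_ev_zero F led).
pose t i (x : F i) : dprod F := fun j => if `[< le i j >] then f j x else 0.
pose h i (x : F i) : SQ D := sqpi D (t i x).
have tl k : is_lin (@t k).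
  move=> a u v; apply: dprod_ext => j; rewrite dprodE /t.
  by case: asboolP => [kj|_]; rewrite ?fl ?scaler0 ?addr0.
have [||u [ul [ug _]]] := gu (SQ D) h.
- by move=> k a u v; rewrite /h tl; apply: (quodata_lin (is_sub_ev_zero F led)).
- move=> k l kl u; apply: (sqpi_eq (d := D)) => //; exists l => j lj.
  have kj := letr _ _ _ kl lj.
  rewrite dprodB /t; case: asboolP => // _; case: asboolP => // _.
  by rewrite fcomp // subrr.
move=> gx; have : h i x = 0 by rewrite -ug gx lin0.
move=> /(@sqpi_ker _ _ D _ Logic.I) [k kP]; have [j [ij kj]] := leD i k.
by exists j; split=> //; have := kP j kj; rewrite /t; case: asboolP.
Qed.

Lemma dirlim_tuple n (y : 'cV[M]_n) i0 :
  exists i (x : 'cV[F i]_n), le i0 i /\ map_mx (@g i) x = y.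
Proof.
have [led [fl [fid fcomp]]] := sys; have [_ [lexx [letr leD]]] := led.
have [gl [gc gu]] := lim.
have [c cP] := choice (fun l => dirlim_onto (y l 0)).
have [i iP] := directed_bound c led; have [j [ij i0j]] := leD i i0.
pose x l := projT1 (cid (cP l)).
have xP l : g (x l) = y l 0 := projT2 (cid (cP l)).
exists j, (\col_l f j (x l)); split=> //; apply: colP0 => l; rewrite !mxE gc //.
exact: letr (iP l) ij.
Qed.

Lemma dirlim_ker_tuple n i (x : 'cV[F i]_n) : map_mx (@g i) x = 0 ->
  exists j, le i j /\ map_mx (@f i j) x = 0.
Proof.
have [led [fl [fid fcomp]]] := sys; have [_ [lexx [letr leD]]] := led.
move=> gx.
have kex l : exists j, le i j /\ f j (x l 0) = 0.
  by apply: dirlim_ker; have := congr1 (fun z : 'cV[M]_n => z l 0) gx; rewrite !mxE.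
have [c cP] := choice kex.
have [j' jP] := directed_bound c led; have [j [jj ij]] := leD j' i.
exists j; split=> //; apply: colP0 => l; rewrite !mxE.
have [icl fcl] := cP l; have clj := letr _ _ _ (jP l) jj.
by rewrite -(fcomp _ _ _ icl clj) fcl (lin0 (fl _ _ clj)).
Qed.

End DirectLimits.

Section Stationarity.
Variables (R : pzRingType) (A BB : mclass R).
Local Notation S := (R^c).
Hypothesis cot : cotorsion_pair A BB.

(** Let x lift to [F i], let j be given by the Mittag-Leffler property, and take (w, r) from a
    presentation of [F j]. A solution in B is a map on [F j], and its restriction to [F i] also
    comes from a stage so late that the witnesses of a given formula true of x have appeared in
    it. *)
Lemma stationary_dominates (M : rmod R) B a (x : 'cV[M]_a) : stationary BB M -> BB B ->
  exists n k (w : 'M[S]_(a, n)) (r : 'M[S]_(k, n)), sat w r x /\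
    forall b : 'cV[B]_a, sat w r b ->
    forall n' k' (w' : 'M[S]_(a, n')) (r' : 'M[S]_(k', n')), sat w' r' x -> sat w' r' b.
Proof.
move=> [I [le [F [f [g [sys [fp [lim ml]]]]]]]] BBB.
have [led [fl [fid fcomp]]] := sys; have [[i0 _] [lexx [letr leD]]] := led.
have [gl [gc gu]] := lim.
have [i [x' [_ xE]]] := dirlim_tuple sys lim x i0.
have [j [ij jP]] := ml B BBB i.
have [n [k [y [r [yg [yr ys]]]]]] := fp j.
pose yc : 'cV[F j]_n := \col_l y l.
pose rm : 'M[S]_(k, n) := \matrix_(l, q) r l q.
have ryc : rm *v yc = 0.
  by apply: colP0 => l; rewrite mactE [RHS]mxE -[RHS](yr l); apply: eq_bigr => q _; rewrite !mxE.
have [w wE] : exists w : 'M[S]_(a, n), map_mx (@f i j) x' = w *v yc.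
  apply/all_in_rowspan => l; have [c cE] := yg (map_mx (@f i j) x' l 0).
  by exists (\row_q c q); rewrite cE mactE; apply: eq_bigr => q _; rewrite !mxE.
exists n, k, w, rm; split.
  exists (map_mx (@g j) yc); rewrite -!map_mact // -wE ryc map_mx0_lin //; split=> //.
  by rewrite map_mxc -xE; apply: map_mx_eq => t; rewrite gc.
move=> b [z [wz rz]] n' k' w' r' [z' [wz' rz']].
(* The rows of rm generate all relations among the generators yc and are satisfied by z, so sending
   yc to z does not depend on the choice of coordinates. *)
have hex (u : F j) : exists v, forall c : 'rV[S]_n, u = (c *v yc) 0 0 -> v = (c *v z) 0 0.
  have [c0 c0E] := yg u; exists ((\row_l c0 l *v z) 0 0) => c cE.
  apply/eqP; rewrite -subr_eq0 -colB -mactBl.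
  have [|d dE] := ys (fun l => (\row_l c0 l - c) 0 l).
    rewrite -[RHS](subrr u) {1}c0E cE mactE -sumrB; apply: eq_bigr => q _.
    by rewrite !mxE scalerBl.
  have -> : \row_l c0 l - c = \row_q d q *m rm.
    by apply/rowP => q; rewrite dE [RHS]mxE; apply: eq_bigr => l _; rewrite !mxE.
  by rewrite mactA rz mact0r mxE.
have [h hP] := choice hex.
have yspan u : exists c : 'rV[S]_n, u = (c *v yc) 0 0.
  have [c cE] := yg u; exists (\row_l c l); rewrite {1}cE mactE.
  by apply: eq_bigr => l _; rewrite !mxE.
have hl : is_lin h.
  move=> c u v; have [cu uE] := yspan u; have [cv vE] := yspan v.
  rewrite (hP u cu) // (hP v cv) // (hP _ (c *: cu + cv)) mactDl colD mactZl //.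
  by rewrite -uE -vE.
have hyc : map_mx h yc = z.
  apply: colP0 => l; rewrite mxE (hP _ (delta_mx 0 l)) mact_delta //.
pose phi u := h (f i j u).
have phix : map_mx phi x' = b.
  by rewrite -[LHS](map_mxc (@f i j) h) wE map_mact // hyc.
have [k1 [z1 [jk1 z1E]]] := dirlim_tuple sys lim z' j.
have ik1 := letr _ _ _ ij jk1.
(* The equations that z' satisfies in M already hold at some stage k2. *)
have [|k2 [k12 k2E]] := @dirlim_ker_tuple _ _ _ _ _ _ _ sys lim _ k1
    (col_mx (w' *v z1 - map_mx (@f i k1) x') (r' *v z1)).
  rewrite map_col_mx map_mxB_lin // !map_mact // z1E wz' rz' map_mxc.
  rewrite (map_mx_eq _ (g := @g i)); last by move=> t; rewrite gc.
  by rewrite xE subrr col_mx0.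
have jk2 := letr _ _ _ jk1 k12.
have [psi [psil psiE]] : exists psi : F k2 -> B, is_lin psi /\ forall t, phi t = psi (f i k2 t).
  by apply/(jP k2 jk2); exists h.
have fl2 := fl _ _ k12.
move: k2E; rewrite map_col_mx map_mxB_lin // !map_mact // map_mxc.
rewrite (map_mx_eq _ (g := @f i k2)); last by move=> t; rewrite fcomp.
rewrite -col_mx0 => /eq_col_mx [/eqP]; rewrite subr_eq0 => /eqP wz2 rz2.
move: (map_mx (@f k1 k2) z1) wz2 rz2 => z2 wz2 rz2.
exists (map_mx psi z2); rewrite -!map_mact // wz2 rz2.
rewrite map_mx0_lin //; split=> //; rewrite map_mxc -phix.
by apply: map_mx_eq => t; rewrite psiE.
Qed.

(* One formula works for all of BB: otherwise take the product of
   counterexamples over all formulas. *)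
Lemma stationary_pp_dominated (M : rmod R) : stationary BB M -> pp_dominated BB M.
Proof.
move=> st a x; apply: contrapT => nex.
pose form := {n : nat & {k : nat & ('M[S]_(a, n) * 'M[S]_(k, n))%type}}.
pose fsat (t : form) (C : rmod R) (c : 'cV[C]_a) :=
  sat (projT2 (projT2 t)).1 (projT2 (projT2 t)).2 c.
pose form1 := {t : form | fsat t M x}.
have cex (t : form1) : exists (B : rmod R) (b : 'cV[B]_a), [/\ BB B, fsat (sval t) B b &
    exists t', fsat t' M x /\ ~ fsat t' B b].
  apply: contrapT => nB; apply: nex; case: t nB => -[n [k [w r]]] [z [/= wz rz]] nB.
  exists n, k, w, r, z; split=> // B BBB b sb n' k' w' r' sx.
  apply: contrapT => ns; apply: nB; exists B, b; split=> //.
  by exists (existT _ n' (existT _ k' (w', r'))).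
pose F t := projT1 (cid (cex t)).
pose b t : 'cV[F t]_a := projT1 (cid (projT2 (cid (cex t)))).
have bP t : [/\ BB (F t), fsat (sval t) (F t) (b t) &
    exists t', fsat t' M x /\ ~ fsat t' (F t) (b t)] := projT2 (cid (projT2 (cid (cex t)))).
have BP : BB (dprod F) by apply: (dprod_BB cot) => t; have [] := bP t.
have [n [k [w [r [sx dx]]]]] := stationary_dominates x st BP.
pose t0 : form1 := exist _ (existT _ n (existT _ k (w, r))) sx.
have [_ sb [[n' [k' [w' r']]] [sx' ns]]] := bP t0; apply: ns.
(* The tuple with [b t0] in coordinate t0 and zero elsewhere satisfies (w, r) in the product, hence
   also (w', r'); projection to coordinate t0 gives the contradiction. *)
have /= := dx (map_mx (@dsingle _ _ F t0) (b t0)) (sat_map (@dsingle_lin _ _ F t0) sb)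
  _ _ _ _ sx'.
move=> /(sat_map (@is_lin_proj _ _ F t0)); rewrite map_mxc.
rewrite (map_mx_eq _ (g := id)) ?map_mx_id //.
by move=> t; apply: dsingle_eq.
Qed.

(** * The system of finitely presented stages of a free cover *)

Section PPStationary.
Variable M : rmod R.
Local Notation G := (freemod R M).
Variable p : G -> M.
Hypotheses (pl : is_lin p) (pE : forall t, p (fgen R t) = t).

(** Finitely many basis elements with finitely many relations true in M. The stages are subquotients
    of the one module G, so that transition maps come from inclusions of spans. *)
Record fpidx := FpIdx {
  ixn : nat; ixv : 'I_ixn -> M; ixk : nat; ixr : 'M[S]_(ixk, ixn);
  ix_inj : injective ixv;
  ix_ker : map_mx p (ixr *v fgens R ixv) = 0 }.

Definition fpdata (i : fpidx) : sqdata G.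
Proof.
refine (@SqData R G (rowspan (fgens R (@ixv i))) (rowspan (ixr i *v fgens R (@ixv i)))
  (is_sub_rowspan _) (is_sub_rowspan _) _).
by move=> v; apply: rowspan_mact.
Defined.

Definition fple (i j : fpidx) :=
  (forall v, sqP (fpdata i) v -> sqP (fpdata j) v) /\
  (forall v, sqN (fpdata i) v -> sqN (fpdata j) v).

Lemma fpidx_contains m (x : 'cV[G]_m) k (ka : 'cV[G]_k) : map_mx p ka = 0 ->
  exists i, (forall v, rowspan x v -> sqP (fpdata i) v) /\
            (forall v, rowspan ka v -> sqN (fpdata i) v).
Proof.
move=> pka; have [n [v [wr [vi vE]]]] := free_coords (col_mx x ka).
have [xE kaE] : x = usubmx wr *v fgens R v /\ ka = dsubmx wr *v fgens R v.
  by move: vE; rewrite -{1}[wr]vsubmxK mact_col => /eq_col_mx.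
have pr : map_mx p (dsubmx wr *v fgens R v) = 0 by rewrite -kaE.
exists (FpIdx vi pr); split=> u /=; last by rewrite -kaE.
by rewrite xE; apply: rowspan_mact.
Qed.

Lemma fple_directed : directed fple.
Proof.
split.
  have p0 : map_mx p (0 : 'cV[G]_0) = 0 by apply: colP0 => -[].
  by have [i _] := fpidx_contains (0 : 'cV[G]_0) p0; exists i.
split; first by move=> i; split.
split=> [i j k [P1 N1] [P2 N2]|i j]; first by split=> v; [move/P1/P2|move/N1/N2].
have pij : map_mx p (col_mx (ixr i *v fgens R (@ixv i)) (ixr j *v fgens R (@ixv j))) = 0.
  by rewrite map_col_mx !ix_ker col_mx0.
have [k [Pk Nk]] := fpidx_contains (col_mx (fgens R (@ixv i)) (fgens R (@ixv j))) pij.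
by exists k; split; split=> v /=; move=> H; [apply: Pk|apply: Nk|apply: Pk|apply: Nk];
  do ?[exact: rowspan_colu H]; exact: rowspan_cold H.
Qed.

Lemma map_fgens n (v : 'I_n -> M) : map_mx p (fgens R v) = \col_l v l.
Proof. by apply: colP0 => l; rewrite !mxE pE. Qed.

Lemma fpidx_fin_presented i : fin_presented (SQ (fpdata i)).
Proof.
pose e := fgens R (@ixv i); pose pi := sqpi (fpdata i) : G -> SQ (fpdata i).
have pil : lin_on (rowspan e) pi by apply: (sqpi_lin (d := fpdata i)).
have Ps := is_sub_rowspan e.
have piE k (c : 'M[S]_(k, ixn i)) l : pi ((c *v e) l 0) = \sum_q c l q *: pi (e q 0).
  rewrite mactE (lin_on_sum Ps pil); last by move=> q _; apply: subZ => //; apply: rowspan_in.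
  by apply: eq_bigr => q _; rewrite (lin_onZ Ps pil) //; apply: rowspan_in.
exists (ixn i), (ixk i), (fun l => pi (e l 0)), (fun k l => ixr i k l); split=> [x|].
  have [c cE] := sqval_in x; exists (fun l => c 0 l).
  by rewrite -piE -cE /pi sqvalK.
split=> [k|c c0].
  by rewrite -piE; apply: (sqpi_eq0 (d := fpdata i)); apply: rowspan_in.
have : pi ((\row_l c l *v e) 0 0) = 0.
  by rewrite piE -[RHS]c0; apply: eq_bigr => q _; rewrite mxE.
move=> /(@sqpi_ker _ _ (fpdata i)) /= []; first by exists (\row_l c l).
move=> d dE; exists (fun k => d 0 k) => l.
have : \row_l c l = d *m ixr i.
  apply: (fgens_free (@ix_inj i)); rewrite mactA; apply: colP0 => q; rewrite !ord1.
  exact: dE.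
by move=> /(congr1 (fun y : 'rV[S]__ => y 0 l)); rewrite !mxE.
Qed.

Lemma fpidx_hom_ML B : BB B -> pp_dominated BB M ->
  hom_ML fple (sqtrans (d := fpdata)) B.
Proof.
move=> BBB dM i; have [_ [lexx [letr leD]]] := fple_directed.
pose x := \col_l @ixv i l : 'cV[M]_(ixn i).
have [n [k [w [r [z [wz rz dx]]]]]] := dM _ x.
pose ei := fgens R (@ixv i); pose ez := map_mx (@fgen R M) z.
have pez : map_mx p ez = z by apply: colP0 => l; rewrite !mxE pE.
have pei : map_mx p ei = x by rewrite map_fgens.
(* Stage j contains the generators of stage i, the tuple ez and the equations [ei = w ez],
   [r ez = 0]; a map on stage j therefore gives a tuple satisfying (w, r). *)
pose ka := col_mx (ixr i *v ei) (col_mx (r *v ez) (ei - w *v ez)).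
have pka : map_mx p ka = 0.
  rewrite !map_col_mx ix_ker map_mxB_lin // !map_mact // pez pei wz rz subrr.
  by rewrite !col_mx0.
have [j [Pj Nj]] := fpidx_contains (col_mx ei ez) pka.
have ij : fple i j.
  split=> v /= vi; first by apply: Pj; apply: rowspan_colu.
  by apply: Nj; apply: rowspan_colu.
exists j; split=> // t jt phi; have it := letr _ _ _ ij jt.
split=> [[psi [psil psiE]]|[psi [psil psiE]]].
  exists (fun q => psi (sqtrans t q)); split.
    by apply: is_lin_comp psil; apply: sqtrans_lin jt => u v.
  move=> q; rewrite psiE.
  have [_ [_ [_ fc]]] := sqtrans_system fple_directed (fun i j ij => ij).
  by rewrite fc.
pose psi0 (u : G) := psi (sqpi (fpdata j) u).
have psi0l : lin_on (sqP (fpdata j)) psi0.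
  by move=> a u v Pu Pv; rewrite /psi0 (sqpi_lin (d := fpdata j)).
have psi0N u : sqN (fpdata j) u -> psi0 u = 0.
  by move=> Nu; rewrite /psi0 (sqpi_eq0 (d := fpdata j)) // lin0.
have Pei : all_in (sqP (fpdata j)) ei.
  by move=> l; apply: Pj; apply: rowspan_colu; apply: rowspan_in.
have Pez : all_in (sqP (fpdata j)) ez.
  by move=> l; apply: Pj; apply: rowspan_cold; apply: rowspan_in.
have Pjs := sqP_sub (fpdata j).
have sb : sat w r (map_mx psi0 ei).
  exists (map_mx psi0 ez); rewrite -!(map_mact_on _ Pjs psi0l) //; split.
    apply: colP0 => l; rewrite [LHS]mxE [RHS]mxE; apply/eqP; rewrite eq_sym -subr_eq0.
    rewrite -(lin_onB Pjs psi0l (Pei l) (all_in_mact w Pjs Pez l)) -colB.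
    apply/eqP/psi0N/Nj; apply: rowspan_cold; apply: rowspan_cold; exact: rowspan_in.
  apply: colP0 => l; rewrite [LHS]mxE [RHS]mxE; apply/psi0N/Nj.
  by apply: rowspan_cold; apply: rowspan_colu; apply: rowspan_in.
(* Written in the generators of stage t, the tuple x satisfies in M the formula given by wt and the
   relations of that stage. Domination transfers the formula to B, where a solution is a map on
   stage t. *)
have [wt wtE] : exists wt, ei = wt *v fgens R (@ixv t).
  by apply/all_in_rowspan => l; apply: it.1; apply: rowspan_in.
have [|zt [wzt rzt]] := dx B BBB _ sb _ _ wt (ixr t).
  exists (map_mx p (fgens R (@ixv t))); rewrite -!map_mact // -wtE pei.
  by rewrite ix_ker.
have [H [Hl HE]] := free_lift_inj zt (@ix_inj t).
have HN u : sqN (fpdata t) u -> H u = 0.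
  move=> Nu; apply: (rowspan_sub (is_sub_ker Hl) _ Nu) => l.
  have := congr1 (fun y : 'cV[B]_(ixk t) => y l 0) rzt.
  by rewrite -HE -map_mact // [in LHS]mxE => ->; rewrite mxE.
exists (fun q => H (sqval q)); split.
  by apply: (@sqval_lin _ _ (fpdata t)) => //; apply: lin_onT.
move=> q; rewrite psiE.
have [c cE] := sqval_in q.
have Pcj : sqP (fpdata j) (sqval q) by apply: ij.1; apply: sqval_in.
have -> : psi (sqtrans j q) = psi0 (sqval q) by [].
have -> : H (sqval (sqtrans t q)) = H (sqval q).
  apply: (sqval_pi_fun (d := fpdata t) (lin_onT (P := _) Hl) HN).
  by apply: it.1; apply: sqval_in.
have E (h : G -> B) : h ((c *v ei) 0 0) = map_mx h (c *v ei) 0 0 by rewrite [RHS]mxE.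
rewrite cE !E (map_mact_on _ Pjs psi0l) // map_mact //.
by rewrite -wzt -HE -map_mact // -wtE.
Qed.

Lemma fpidx_dirlim :
  is_dirlim fple (sqtrans (d := fpdata)) (fun i (q : SQ (fpdata i)) => p (sqval q)).
Proof.
apply: (sqtrans_dirlim fple_directed) => [i j //|i|y|i v _ pv|i v].
- exact: lin_onT.
- have p0 : map_mx p (0 : 'cV[G]_0) = 0 by apply: colP0 => -[].
  have [i [Pi _]] := fpidx_contains (single (fgen R y)) p0; exists i, (fgen R y).
  by split=> //; apply: Pi; apply: rowspan_single.
- have ps : map_mx p (single v) = 0 by apply: colP0 => l; rewrite !mxE.
  by have [j [_ Nj]] := fpidx_contains (single v) ps; exists j; apply: Nj; apply: rowspan_single.
- move=> Nv; apply: (rowspan_sub (is_sub_ker pl) _ Nv) => l.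
  have := congr1 (fun y : 'cV[M]_(ixk i) => y l 0) (ix_ker i).
  by rewrite [in LHS]mxE => ->; rewrite mxE.
Qed.

End PPStationary.

Lemma pp_dominated_stationary (M : rmod R) : pp_dominated BB M -> stationary BB M.
Proof.
move=> dM; have [p [pl _ pE]] := free_cover M.
exists (fpidx p), (@fple M p), (fun i => SQ (fpdata i)), (sqtrans (d := @fpdata M p)),
  (fun i q => p (sqval q)).
split; first by apply: sqtrans_system; [exact: fple_directed | move=> i j].
split; first exact: fpidx_fin_presented.
split; first exact: fpidx_dirlim.
by move=> B BBB; apply: fpidx_hom_ML.
Qed.

End Stationarity.

(** * Locally free modules are stationary pure-epimorphic images *)

(** Dependent choice for states whose type varies with the step, as for tuples whose length depends
    on the stage of a tower. *)
Lemma choice_seq (T : nat -> Type) (P : forall n, T n -> Prop)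
    (step : forall n, T n -> T n.+1 -> Prop) (t0 : T 0%N) :
  P 0%N t0 -> (forall n t, P n t -> exists t', P n.+1 t' /\ step n t t') ->
  exists s : forall n, T n, s 0%N = t0 /\ forall n, P n (s n) /\ step n (s n) (s n.+1).
Proof.
move=> P0 H.
have H' n (x : {t | P n t}) : exists x' : {t | P n.+1 t}, step n (sval x) (sval x').
  by have [t' [Pt st]] := H n _ (svalP x); exists (exist _ t' Pt).
pose s := fix s n : {t | P n t} :=
  if n is m.+1 then projT1 (cid (H' m (s m))) else exist _ t0 P0.
exists (fun n => sval (s n)); split=> // n; split; first exact: svalP.
exact: projT2 (cid (H' n (s n))).
Qed.

Section LocallyFree.
Variables (R : pzRingType) (A BB : mclass R).
Local Notation S := (R^c).
Hypothesis cot : cotorsion_pair A BB.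
Hypothesis clB : closed_dirlim BB.

Section Members.
Variables (M : rmod R) (N : M -> Prop).
Hypothesis subN : submodule_in (countable_part A) N.

Lemma member_is_sub : is_sub N.
Proof.
have [N' [e [_ [el [ei eN]]]]] := subN; split.
  by apply/eN; exists 0; apply: lin0.
by move=> a x y /eN [x' <-] /eN [y' <-]; apply/eN; exists (a *: x' + y').
Qed.

Lemma member_generated : exists X : nat -> M, (forall i, N (X i)) /\
  forall y, N y -> exists n (c : nat -> S), y = \sum_(i < n) c i *: X i.
Proof.
have [N' [e [[_ [g [b [r [gg _]]]]] [el [ei eN]]]]] := subN.
exists (fun i => e (g i)); split=> [i|y /eN [y' <-]]; first by apply/eN; exists (g i).
have [n [c ->]] := gg y'; exists n, c.
by rewrite (lin_sum el); apply: eq_bigr => i _; rewrite (linZ el).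
Qed.

(** The approximation is made in the module N' that N is a copy of; its maps are carried back by
    inverting the embedding e on N, which is why h is linear on N only. *)
Lemma member_hom_approximable a (x : 'cV[M]_a) : all_in N x ->
  exists n k (w : 'M[S]_(a, n)) (r : 'M[S]_(k, n)) (z : 'cV[M]_n),
    [/\ all_in N z, w *v z = x, r *v z = 0 & forall B, BB B -> forall b : 'cV[B]_a,
      sat w r b -> exists h : M -> B, lin_on N h /\ map_mx h x = b].
Proof.
move=> Nx; have [N' [e [[AN _] [el [ei eN]]]]] := subN.
have [x' xE] : exists x' : 'cV[N']_a, forall i, e (x' i 0) = x i 0.
  by apply: (@col_lift _ _ (fun u v => e v = u)) => i; apply/eN.
have {}xE : map_mx e x' = x by apply: colP0 => i; rewrite mxE.
have [n [k [w [r [z [wz rz zP]]]]]] := cot_hom_approximable cot clB AN x'.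
exists n, k, w, r, (map_mx e z); split.
- by move=> i; rewrite mxE; apply/eN; exists (z i 0).
- by rewrite -map_mact // wz.
- by rewrite -map_mact // rz map_mx0_lin.
move=> B BBB b /(zP B BBB) [h [hl hx]].
have gex y : exists u, N y -> e u = y.
  by have [/eN [u uE]|nN] := pselect (N y); [exists u | exists 0].
have [g gP] := choice gex.
have ge u : g (e u) = u by apply: ei; apply: gP; apply/eN; exists u.
exists (fun y => h (g y)); split.
  move=> c u v /eN [u' <-] /eN [v' <-].
  by rewrite -el !ge hl.
by rewrite -xE map_mxc -hx; apply: map_mx_eq => t; rewrite ge.
Qed.

End Members.

Section Family.
Variables (M : rmod R) (SS : (M -> Prop) -> Prop).
Hypothesis SSin : forall N, SS N -> submodule_in (countable_part A) N.
Hypothesis SScov : forall X : nat -> M, exists N, SS N /\ forall n, N (X n).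

Lemma family_enlarge N m (y : 'cV[M]_m) : SS N ->
  exists N', [/\ SS N', forall u, N u -> N' u & all_in N' y].
Proof.
move=> SN; have [X [NX Xgen]] := member_generated (SSin SN).
(* The first m terms of the sequence are the entries of y; the generators of N follow, shifted by
   m. *)
have [N' [SN' N'X]] := SScov (fun i => if insub i is Some l then y l 0 else X (i - m)%N).
exists N'; split=> // [u /Xgen [n [c ->]]|l].
  have N's := member_is_sub (SSin SN').
  apply: (sub_sum N's) => i _; apply: (subZ N's).
  by have := N'X (i + m)%N; rewrite insubF ?addnK // ltnNge leq_addl.
by have := N'X l; case: insubP => [u _ /ord_inj ->|]; rewrite ?ltn_ord.
Qed.

(* A chain of members, each admitting too many maps to extend to the next one,
   would contradict the approximability of its union. *)
Lemma family_pp_dominated : 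
  (forall C : nat -> (M -> Prop), (forall n, SS (C n)) ->
    (forall m n, (forall x, C m x -> C n x) \/ (forall x, C n x -> C m x)) ->
    memS SS (fun x => exists n, C n x)) ->
  pp_dominated BB M.
Proof.
move=> SSchain a x.
have [N0 [SN0 xN0]] : exists N0, SS N0 /\ all_in N0 x.
  have [N [SN _]] := SScov (fun _ => 0).
  by have [N0 [SN0 _ xN0]] := family_enlarge x SN; exists N0.
pose ext_to (N : M -> Prop) (B : rmod R) (b : 'cV[B]_a) :=
  exists h : M -> B, lin_on N h /\ map_mx h x = b.
pose form := {n : nat & {k : nat & ('M[S]_(a, n) * 'M[S]_(k, n))%type}}.
pose fsat (t : form) (C : rmod R) (c : 'cV[C]_a) :=
  sat (projT2 (projT2 t)).1 (projT2 (projT2 t)).2 c.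
pose good (st : (M -> Prop) * form) := [/\ SS st.1, all_in st.1 x,
  exists z, [/\ all_in st.1 z, (projT2 (projT2 st.2)).1 *v z = x
             & (projT2 (projT2 st.2)).2 *v z = 0] &
  forall B, BB B -> forall b : 'cV[B]_a, fsat st.2 B b -> ext_to st.1 B b].
have goodex N : SS N -> all_in N x -> exists t, good (N, t).
  move=> SN xN; have [n [k [w [r [z [zN wz rz zP]]]]]] := member_hom_approximable (SSin SN) xN.
  exists (existT _ n (existT _ k (w, r))); split; [exact: SN|exact: xN|by exists z|].
  exact: zP.
apply: contrapT => nex.
(* A step records a failure: b satisfies the formula of st but is not the value at x of any map
   linear on the next member. *)
pose step (_ : nat) (st st' : (M -> Prop) * form) := (forall y, st.1 y -> st'.1 y) /\
  exists (B : rmod R) (b : 'cV[B]_a), [/\ BB B, fsat st.2 B b & ~ ext_to st'.1 B b].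
have [t0 g0] := goodex N0 SN0 xN0.
have [|s [_ sP]] := @choice_seq (fun _ => _) (fun _ => good) step _ g0.
  (* If no step starts at (N, t), its formula dominates: a witness ze of another formula lies in a
     larger member N', and a map on N' with value b at x carries ze to a witness in B. *)
  move=> n0 [N t] gN; apply: contrapT => nst; apply: nex.
  have [/= SN xN [z [zN wz rz]] NP] := gN.
  exists (projT1 t), (projT1 (projT2 t)), (projT2 (projT2 t)).1, (projT2 (projT2 t)).2, z.
  split=> // B BBB b sb n' k' w' r' [ze [wze rze]].
  have [N' [SN' NN' zeN']] := family_enlarge ze SN.
  have xN' : all_in N' x by move=> l; apply: NN'.
  have [t' g'] := goodex N' SN' xN'.
  have [h [hl hx]] : ext_to N' B b.
    apply: contrapT => nE; apply: nst; exists (N', t'); split=> //; split=> //.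
    by exists B, b.
  have N's := member_is_sub (SSin SN').
  exists (map_mx h ze); rewrite -!(map_mact_on _ N's hl zeN') wze rze hx; split=> //.
  by apply: colP0 => l; rewrite !mxE (lin_on0 N's hl).
have mono m n : (m <= n)%N -> forall y, (s m).1 y -> (s n).1 y.
  elim: n => [|n IH]; first by rewrite leqn0 => /eqP ->.
  rewrite leq_eqVlt => /orP [/eqP -> //|/IH {}IH y /IH].
  by have [_ [st _]] := sP n; apply: st.
have [||U [SU UE]] := SSchain (fun n => (s n).1).
- by move=> n; have [[]] := sP n.
- move=> m n; case/orP: (leq_total m n) => mn; [left|right]; exact: mono.
have xU : all_in U x by move=> l; apply/UE; exists 0%N; have [[_ x0 _ _] _] := sP 0%N; apply: x0.
(* The formula t of the union has its witness in some [s n]. The tuple b that fails there comes from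
   a map on [s n], so it satisfies t, so it comes from a map on the union and in particular on the
   next member. *)
have [t [/= _ _ [z [zU wz rz]] tP]] := goodex U SU xU.
have [n zn] : exists n, all_in (s n).1 z.
  have [c cP] := choice (fun l => (UE (z l 0)).1 (zU l)).
  exists (\max_l c l)%N => l; apply: mono (cP l); exact: leq_bigmax.
have [[Sn xn _ gn] [_ [B [b [BBB sb nE]]]]] := sP n.
have [h [hl hx]] := gn B BBB b sb.
have Ns := member_is_sub (SSin Sn).
have [|h' [hl' hx']] := tP B BBB b.
  exists (map_mx h z); rewrite -!(map_mact_on _ Ns hl zn) wz rz hx; split=> //.
  by apply: colP0 => l; rewrite !mxE (lin_on0 Ns hl).
apply: nE; exists h'; split=> // d u v Su Sv; apply: hl'; apply/UE; by exists n.+1.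
Qed.

(** The direct sum of all members is in A and maps onto M. The image of a finitely presented module
    is finitely generated, so it lies in one member and the map lifts to that summand. *)
Lemma family_pure_epi : exists (N : rmod R) (p : N -> M), A N /\ pure_epi p.
Proof.
pose J := {N : M -> Prop | SS N}.
pose F (j : J) : rmod R := projT1 (cid (SSin (svalP j))).
have Fex (j : J) := projT2 (cid (SSin (svalP j))).
pose e (j : J) : F j -> M := projT1 (cid (Fex j)).
have eP j : countable_part A (F j) /\ is_lin (e j) /\ injective (e j) /\
  (forall x, sval j x <-> exists y, e j y = x) := projT2 (cid (Fex j)).
have [p [pl pE]] := dsum_lift (fun j => (eP j).2.1).
exists (dsum F), p; split.
  apply/cot.1 => B BBB; apply: Ext1_zero_dsum => j.
  by apply: (cot_Ext cot) => //; have [[]] := eP j.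
split=> //; split=> [y|C phi [n [m [g [_ [gg _]]]]] phil].
  have [N [SN Ny]] := SScov (fun _ => y).
  have [_ [_ [_ eN]]] := eP (exist _ N SN).
  by have [u <-] := (eN y).1 (Ny 0%N); exists (dinj u).
have [N0 [SN0 _]] := SScov (fun _ => 0).
have [N [SN _ gN]] := family_enlarge (\col_i phi (g i)) SN0.
have Ns := member_is_sub (SSin SN).
have [_ [el [ei eN]]] := eP (exist _ N SN).
have uex x : exists u, e (exist _ N SN) u = phi x.
  apply/eN => /=; have [c ->] := gg x; rewrite (lin_sum phil).
  apply: (sub_sum Ns) => i _; rewrite (linZ phil); apply: (subZ Ns).
  by have := gN i; rewrite mxE.
have [u uP] := choice uex; exists (fun x => dinj (u x)); split.
  move=> a x y; rewrite -(@dinj_lin R J F); congr dinj.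
  by apply: ei; rewrite el !uP phil.
by move=> x; rewrite pE uP.
Qed.

End Family.

Lemma locally_free_pp_dominated (M : rmod R) : locally_free A M -> pp_dominated BB M.
Proof. by move=> [SS [SSin [_ [chain cov]]]]; apply: (family_pp_dominated SSin cov chain). Qed.

Lemma locally_free_pure_epi (M : rmod R) : locally_free A M ->
  exists (N : rmod R) (p : N -> M), A N /\ pure_epi p.
Proof. by move=> [SS [SSin [_ [_ cov]]]]; apply: (family_pure_epi SSin cov). Qed.

End LocallyFree.

(** * Character modules cogenerate *)

Section DivisibleExtension.
Variables (Y D : zmodType).
Hypothesis divD : forall (d : D) n, (0 < n)%N -> exists d', d' *+ n = d.

(** Partial additive maps from Y to D are represented by their graphs. *)
Definition additive_graph (Ga : Y * D -> Prop) :=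
  [/\ Ga 0, forall p q, Ga p -> Ga q -> Ga (p - q) & forall d, Ga (0, d) -> d = 0].

Lemma graphMz Ga p (n : int) : additive_graph Ga -> Ga p -> Ga (p *~ n).
Proof.
move=> [G0 GB _] Gp.
have GN q : Ga q -> Ga (- q) by move=> Gq; rewrite -sub0r; apply: GB.
have Gn m : Ga (p *+ m).
  elim: m => [|m IH]; first by rewrite mulr0n.
  by rewrite mulrS -[p *+ m]opprK; apply: GB => //; apply: GN.
by case: n => m; [rewrite -pmulrn | rewrite NegzE mulrNz -pmulrn; apply: GN].
Qed.

Lemma pair_mulz (y : Y) (d : D) (n : int) : (y, d) *~ n = (y *~ n, d *~ n).
Proof.
have E m : (y, d) *+ m = (y *+ m, d *+ m).
  by elim: m => [|m IH]; rewrite ?mulr0n // !mulrS IH.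
by case: n => m; rewrite ?NegzE ?mulrNz -?pmulrn E.
Qed.

(** If positive multiples of y lie in the domain, let m be the least and c its value. Division with
    remainder shows that m divides every n with [y *~ n] in the domain, so any d0 with [d0 *+ m = c]
    is consistent. Otherwise 0 will do. *)
Lemma graph_step Ga (y : Y) : additive_graph Ga ->
  exists d0, forall (n : int) d, Ga (y *~ n, d) -> d = d0 *~ n.
Proof.
move=> aG; have [G0 GB Gf] := aG.
have [ex|nex] := pselect (exists m : nat, `[< (0 < m)%N /\ exists d, Ga (y *+ m, d) >]); last first.
  exists 0 => n d Gn; rewrite mul0rz.
  have [n0|n0] := eqVneq n 0; first by apply: Gf; rewrite n0 mulr0z in Gn.
  case: nex; exists `|n|%N; apply/asboolP; split; first by rewrite absz_gt0.
  case: n Gn n0 => m Gn _; first by exists d; rewrite pmulrn.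
  have := graphMz (-1) aG Gn; rewrite pair_mulz !mulrN1z NegzE mulrNz opprK -pmulrn.
  by exists (- d).
case: (ex_minnP ex) => m /asboolP [m0 [c Gc]] mmin.
have [d0 d0E] := divD c m0; exists d0 => n d Gn.
have nE := divz_eq n m; set q := (n %/ m)%Z in nE; set r := (n %% m)%Z in nE.
have r0 : 0 <= r by apply: modz_ge0; case: (m) m0.
have rm : r < m%:Z by apply: ltz_pmod.
have Gr : Ga (y *~ r, d - c *~ q).
  have := GB _ _ Gn (graphMz q aG Gc); rewrite pair_mulz.
  have -> // : ((y *~ n, d) - (y *+ m *~ q, c *~ q) : Y * D) = (y *~ r, d - c *~ q).
  apply: injective_projections => //=.
  by rewrite nE mulrzDr pmulrn -mulrzA [(q * _)%R]mulrC addrAC subrr add0r.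
have rz : r = 0.
  case: (r) r0 rm Gr => // k _ km Gk; case: k km Gk => // k km Gk.
  have /mmin : `[< (0 < k.+1)%N /\ exists d, Ga (y *+ k.+1, d) >].
    by apply/asboolP; split=> //; exists (d - c *~ q).
  by rewrite leqNgt -ltz_nat km.
move: Gr; rewrite rz mulr0z => /Gf /eqP; rewrite subr_eq0 => /eqP ->.
by rewrite nE rz addr0 -d0E pmulrn -mulrzA mulrC.
Qed.

Lemma divisible_extend Ga0 : additive_graph Ga0 ->
  exists h : Y -> D, (forall x y, h (x + y) = h x + h y) /\
    forall y d, Ga0 (y, d) -> h y = d.
Proof.
move=> aG0.
(* The union with Ga0 makes the property hold for the empty set, which is the union of the empty
   chain. *)
pose P (Ga : set (Y * D)) := additive_graph (Ga0 `|` Ga)%classic.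
have [F FP Ftot|Am [PA Amax]] := @Zorn_bigcup (Y * D)%type P.
  have common p q : (Ga0 `|` \bigcup_(X in F) X)%classic p ->
      (Ga0 `|` \bigcup_(X in F) X)%classic q -> exists Ga, [/\ additive_graph Ga,
        (Ga `<=` Ga0 `|` \bigcup_(X in F) X)%classic, Ga p & Ga q].
    have sub X : F X -> (Ga0 `|` X `<=` Ga0 `|` \bigcup_(X in F) X)%classic.
      by move=> FX u [?|?]; [left | right; exists X].
    move=> [p0|[X FX Xp]] [q0|[X' FX' Xq]].
    - by exists Ga0; split=> // u; left.
    - by exists (Ga0 `|` X')%classic; split; [exact: FP|exact: sub|left|right].
    - by exists (Ga0 `|` X)%classic; split; [exact: FP|exact: sub|right|left].
    - have [XX|XX] := Ftot _ _ FX FX'.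
        by exists (Ga0 `|` X')%classic; split; [exact: FP|exact: sub|right; apply: XX|right].
      by exists (Ga0 `|` X)%classic; split; [exact: FP|exact: sub|right|right; apply: XX].
  split=> [|p q Gp Gq|d Gd]; first by left; have [] := aG0.
    have [Ga [[_ GB _] sub Gap Gaq]] := common p q Gp Gq.
    by apply: sub; apply: GB.
  by have [Ga [[_ _ Gf] _ Gad _]] := common _ _ Gd Gd; apply: Gf.
pose Ga := (Ga0 `|` Am)%classic.
have aG : additive_graph Ga := PA; have [G0 GB Gf] := aG.
have GN q : Ga q -> Ga (- q) by move=> Gq; rewrite -sub0r; apply: GB.
have GD p q : Ga p -> Ga q -> Ga (p + q) by move=> Gp Gq; rewrite -[q]opprK; apply: GB => //; apply: GN.
have dom y : exists d, Ga (y, d).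
  apply: contrapT => nd; have [d0 d0P] := graph_step y aG.
  pose Ga' : set (Y * D) := fun p => exists u (n : int), Ga u /\ p = u + (y, d0) *~ n.
  have GG' p : Ga p -> Ga' p by move=> Gp; exists p, 0; rewrite mulr0z addr0.
  apply: (Amax Ga').
    split; first by move=> p Ap; apply: GG'; right.
    move=> sub; apply: nd; exists d0; right; apply: sub; exists 0, 1.
    by rewrite add0r mulr1z.
  rewrite /P; have -> : (Ga0 `|` Ga')%classic = Ga'.
    by apply/seteqP; split=> p; [case=> // p0; apply: GG'; left | right].
  split=> [|_ _ [u [n [Gu ->]]] [u' [n' [Gu' ->]]]|d [[u c] [n [Gu]]]]; first exact: GG'.
    exists (u - u'), (n - n'); split; first exact: GB.
    by rewrite mulrzBr opprD addrACA.
  rewrite pair_mulz => E; have /= E1 := congr1 fst E; have /= E2 := congr1 snd E.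
  have /d0P : Ga (y *~ n, - c).
    have -> : y *~ n = - u by apply/esym/eqP; rewrite -subr_eq0 -opprD -E1 oppr0.
    exact: (GN _ Gu).
  by move=> /esym E3; rewrite E2 E3 subrr.
have [h hP] := choice dom.
have hu y d : Ga (y, d) -> h y = d.
  move=> Gd; apply/eqP; rewrite -subr_eq0; apply/eqP/Gf.
  by have := GB _ _ (hP y) Gd; rewrite (_ : (y, h y) - (y, d) = (0, h y - d)) //; apply: injective_projections; rewrite /= ?subrr.
exists h; split=> [x y|y d Gd]; first by apply: hu; apply: (GD _ _ (hP x) (hP y)).
by apply: hu; left.
Qed.

End DivisibleExtension.

(** * The divisible group Q/Z *)

Definition rat_int : {pred rat} := fun q => q \is a Num.int.

Lemma rat_int_closed : zmod_closed rat_int.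
Proof. by split=> [|x y]; [exact: rpred0 | exact: rpredB]. Qed.

HB.instance Definition _ := GRing.isZmodClosed.Build rat rat_int rat_int_closed.

Definition ratZ : zmodType := Quotient.quot rat_int.
Definition ratpi (q : rat) : ratZ := (\pi_(ratZ) q)%qT.

Lemma ratpiD x y : ratpi (x + y) = ratpi x + ratpi y.
Proof. exact: (@Quotient.pi_add rat rat_int). Qed.

Lemma ratpi_eq0 x : ratpi x = 0 <-> x \is a Num.int.
Proof.
have z0 : ratpi 0 = 0 by apply: (addrI (ratpi 0)); rewrite -ratpiD !addr0.
rewrite -z0; split=> [/eqP|xZ].
  by rewrite /ratpi -(Quotient.idealrBE rat_int) subr0.
by apply/eqP; rewrite /ratpi -(Quotient.idealrBE rat_int) subr0.
Qed.

Lemma ratpiMn x n : ratpi (x *+ n) = ratpi x *+ n.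
Proof.
elim: n => [|n IH]; first by rewrite !mulr0n; apply/ratpi_eq0; apply: rpred0.
by rewrite !mulrS ratpiD IH.
Qed.

Lemma ratpi_onto d : exists q, ratpi q = d.
Proof. by exists (repr (d : Quotient.quot rat_int)); apply: (@reprK _ (Quotient.quot rat_int)). Qed.

Lemma ratZ_divisible (d : ratZ) n : (0 < n)%N -> exists d', d' *+ n = d.
Proof.
move=> n0; have [q <-] := ratpi_onto d; exists (ratpi (q / n%:R)).
by rewrite -ratpiMn -[q / _ *+ n]mulr_natr divfK // Num.Theory.pnatr_eq0 -lt0n.
Qed.

Lemma ratZ_torsion m : (1 < m)%N -> exists d : ratZ, d <> 0 /\ d *+ m = 0.
Proof.
move=> m1; have m0 : (m%:R : rat) != 0 by rewrite Num.Theory.pnatr_eq0 -lt0n ltnW.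
exists (ratpi m%:R^-1); split.
  move=> /ratpi_eq0 /Num.Theory.intrP [z zE].
  have zm : z * m%:Z = 1.
    by apply: (@intr_inj rat); rewrite intrM -zE -pmulrn mulVf.
  have := dvdz_mull z (dvdzz m%:Z); rewrite zm.
  by rewrite dvdz1 /= => /eqP E; rewrite E in m1.
rewrite -ratpiMn -[_^-1 *+ m]mulr_natr mulVf //; apply/ratpi_eq0; exact: rpred1.
Qed.

(** The module Hom_Z(R, Q/Z); a scalar a will turn f into the map sending x to [f (a * x)], which is
    a right action of R. *)
Definition charmod_sort (R : pzRingType) :=
  {f : R -> ratZ | `[< forall x y, f (x + y) = f x + f y >]}.

Section CharacterModule.
Variable R : pzRingType.
Local Notation S := (R^c).
Local Notation T := (charmod_sort R).

HB.instance Definition _ := gen_eqMixin T.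
HB.instance Definition _ := gen_choiceMixin T.

Definition chval (f : T) : R -> ratZ := sval f.

Lemma chvalD f x y : chval f (x + y) = chval f x + chval f y.
Proof. by case: f => g gP; apply: (asboolW gP). Qed.

Lemma ch_ext (f g : T) : (forall x, chval f x = chval g x) -> f = g.
Proof. by case: f g => f Pf [g Pg] /= E; apply: eq_exist; apply: funext. Qed.

Definition mkch (f : R -> ratZ) (fD : forall x y, f (x + y) = f x + f y) : T :=
  exist _ f (asboolT fD).

Let caddP (f g : T) x y :
  chval f (x + y) + chval g (x + y) = (chval f x + chval g x) + (chval f y + chval g y).
Proof. by rewrite !chvalD addrACA. Qed.
Let cadd f g := mkch (caddP f g).
Let coppP (f : T) x y : - chval f (x + y) = - chval f x - chval f y.
Proof. by rewrite chvalD opprD. Qed.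
Let copp f := mkch (coppP f).
Let czeroP (x y : R) : (0 : ratZ) = 0 + 0. Proof. by rewrite addr0. Qed.
Let czero := mkch czeroP.
Let cscaleP (a : R) (f : T) x y : chval f (a * (x + y)) = chval f (a * x) + chval f (a * y).
Proof. by rewrite mulrDr chvalD. Qed.
Let cscale (a : S) f := mkch (cscaleP a f).

Let caddA : associative cadd.
Proof. by move=> f g h; apply: ch_ext => x; apply: addrA. Qed.
Let caddC : commutative cadd.
Proof. by move=> f g; apply: ch_ext => x; apply: addrC. Qed.
Let cadd0 : left_id czero cadd.
Proof. by move=> f; apply: ch_ext => x; apply: add0r. Qed.
Let caddN : left_inverse czero copp cadd.
Proof. by move=> f; apply: ch_ext => x; apply: addNr. Qed.

HB.instance Definition _ := GRing.isZmodule.Build T caddA caddC cadd0 caddN.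

Let cscaleA (a b : S) f : cscale a (cscale b f) = cscale (a * b) f.
Proof. by apply: ch_ext => x /=; rewrite mulrA. Qed.
Let cscale1 : left_id 1 cscale.
Proof. by move=> f; apply: ch_ext => x /=; rewrite mul1r. Qed.
Let cscaleDr : right_distributive cscale +%R.
Proof. by move=> a f g; apply: ch_ext => x. Qed.
Let cscaleDl f : {morph cscale^~ f : a b / a + b}.
Proof. by move=> a b; apply: ch_ext => x /=; rewrite mulrDl chvalD. Qed.

HB.instance Definition _ :=
  GRing.Zmodule_isLmodule.Build S T cscaleA cscale1 cscaleDr cscaleDl.

Definition charmod : rmod R := T.

(** One direction of the adjunction between Hom_R(V, Hom_Z(R, Q/Z)) and Hom_Z(V, Q/Z): module maps
    are obtained from additive ones. *)
Lemma charmod_adjoint (V : rmod R) (chi : V -> ratZ) :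
  (forall x y, chi (x + y) = chi x + chi y) ->
  exists h : V -> charmod, is_lin h /\ forall v (s : S), chval (h v) s = chi (s *: v).
Proof.
move=> chiD.
have hP v x y : chi ((x + y : S) *: v) = chi ((x : S) *: v) + chi ((y : S) *: v).
  by rewrite scalerDl chiD.
exists (fun v => mkch (hP v) : charmod); split=> // a u v; apply: ch_ext => s /=.
by rewrite scalerDr chiD scalerA.
Qed.

(** Evaluation at 1 extends additively from the submodule to E because Q/Z is divisible, and the
    adjoint of the extension is a retraction. *)
Lemma charmod_injective M : Ext1_zero M charmod.
Proof.
apply: Ext1_zero_retract => E i p il pl ii ps ex.
pose Ga (q : E * ratZ) := exists b, q = (i b, chval b 1).
have aG : additive_graph Ga.
  split=> [|_ _ [b ->] [b' ->]|d [b E1]].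
  - by exists 0; rewrite lin0.
  - by exists (b - b'); rewrite linB.
  have /= E2 := congr1 fst E1; have /= -> := congr1 snd E1.
  by have -> : b = 0 by apply: ii; rewrite -E2 lin0.
have [chi [chiD chiE]] := divisible_extend ratZ_divisible aG.
have [h [hl hE]] := charmod_adjoint chiD; exists h; split=> // b.
apply: ch_ext => s; rewrite hE -(linZ il) (chiE _ (chval ((s : S) *: b) 1)); last by exists ((s : S) *: b).
by rewrite /= mulr1.
Qed.

Lemma charmod_cogenerates (V : rmod R) (v : V) : v <> 0 ->
  exists h : V -> charmod, is_lin h /\ h v <> 0.
Proof.
move=> v0.
(* A nonzero d killed by every integer that kills v makes [v *~ n] to [d *~ n] well defined. It is
   killed by the order of v, or by 2 when v has infinite order. *)
have [d [d0 dv]] : exists d : ratZ, d <> 0 /\ forall n : int, v *~ n = 0 -> d *~ n = 0.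
  have [ex|nex] := pselect (exists m : nat, `[< (0 < m)%N /\ v *+ m = 0 >]); last first.
    have [d [d0 _]] := @ratZ_torsion 2 isT; exists d; split=> // n vn.
    have [->|n0] := eqVneq n 0; first by rewrite mulr0z.
    case: nex; exists `|n|%N; apply/asboolP; split; first by rewrite absz_gt0.
    case: n vn n0 => m vm _; first by rewrite pmulrn.
    by move: vm; rewrite NegzE mulrNz => /eqP; rewrite oppr_eq0 -pmulrn => /eqP.
  case: (ex_minnP ex) => m /asboolP [m0 vm] mmin.
  have m1 : (1 < m)%N.
    by case: m m0 vm {mmin} => [|[|m]] // _; rewrite mulr1n.
  have [d [d0 dm]] := ratZ_torsion m1; exists d; split=> // n vn.
  have nE := divz_eq n m.
  have r0 : 0 <= (n %% m)%Z by apply: modz_ge0; case: (m) m0.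
  have rm : (n %% m)%Z < m%:Z by apply: ltz_pmod.
  have E (V' : zmodType) (x : V') : x *+ m = 0 -> x *~ n = x *~ (n %% m)%Z.
    by move=> xm; rewrite {1}nE mulrzDr mulrC mulrzA -pmulrn xm mul0rz add0r.
  rewrite (E _ _ dm); move: vn; rewrite (E _ _ vm).
  case: (n %% m)%Z r0 rm => // k _ km; case: k km => // k km vk.
  have /mmin : `[< (0 < k.+1)%N /\ v *+ k.+1 = 0 >] by apply/asboolP.
  by rewrite leqNgt -ltz_nat km.
pose Ga (q : V * ratZ) := exists n : int, q = (v *~ n, d *~ n).
have aG : additive_graph Ga.
  split=> [|_ _ [n ->] [n' ->]|e [n E1]].
  - by exists 0; rewrite !mulr0z.
  - by exists (n - n'); rewrite !mulrzBr.
  have /= E2 := congr1 fst E1; have /= -> := congr1 snd E1.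
  by apply: dv.
have [chi [chiD chiE]] := divisible_extend ratZ_divisible aG.
have [h [hl hE]] := charmod_adjoint chiD; exists h; split=> // hv; apply: d0.
have := hE v 1; rewrite scale1r (chiE _ d) ?hv => [//|]; by exists 1; rewrite !mulr1z.
Qed.

End CharacterModule.

(** * Countable spans *)

Section CountableSpans.
Variables (R : pzRingType) (V : rmod R).
Local Notation S := (R^c).

Definition cspan (X : nat -> V) (y : V) :=
  exists n (c : nat -> S), y = \sum_(i < n) c i *: X i.

Lemma sum_widen m n (F : nat -> V) : (m <= n)%N -> (forall i, (m <= i)%N -> F i = 0) ->
  \sum_(i < n) F i = \sum_(i < m) F i.
Proof.
move=> mn F0; rewrite -(subnKC mn) big_split_ord /= [X in _ + X]big1 ?addr0 //.
by move=> i _; apply: F0; apply: leq_addr.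
Qed.

Lemma cspan_widen X y n0 : cspan X y -> exists n (c : nat -> S),
  [/\ (n0 <= n)%N, y = \sum_(i < n) c i *: X i & forall i, (n <= i)%N -> c i = 0].
Proof.
move=> [n [c ->]]; exists (maxn n0 n), (fun i => if (i < n)%N then c i else 0).
split; first exact: leq_maxl; last first.
  by move=> i; rewrite geq_max => /andP [_ ni]; rewrite ltnNge ni.
rewrite (@sum_widen n (maxn n0 n) (fun i => (if (i < n)%N then c i else 0) *: X i)) //.
- by apply: eq_bigr => i _; rewrite ltn_ord.
- exact: leq_maxr.
- by move=> i ni; rewrite ltnNge ni scale0r.
Qed.

Lemma is_sub_cspan X : is_sub (cspan X).
Proof.
split=> [|a x y Cx Cy]; first by exists 0%N, (fun _ => 0); rewrite big_ord0.
have [n [c [_ -> c0]]] := cspan_widen 0 Cx; have [m [d [nm -> d0]]] := cspan_widen n Cy.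
exists m, (fun i => a * c i + d i).
rewrite -(@sum_widen n m (fun i => c i *: X i)) //; last by move=> i /c0 ->; rewrite scale0r.
rewrite scaler_sumr -big_split; apply: eq_bigr => i _.
by rewrite scalerDl scalerA.
Qed.

Lemma cspan_in X i : cspan X (X i).
Proof.
exists i.+1, (fun j => if j == i then 1 else 0).
rewrite big_ord_recr /= eqxx scale1r big1 ?add0r // => j _.
by rewrite (ltn_eqF (ltn_ord j)) scale0r.
Qed.

Lemma cspan_sub X (P : V -> Prop) y : is_sub P -> (forall i, P (X i)) -> cspan X y -> P y.
Proof. by move=> Ps PX [n [c ->]]; apply: (sub_sum Ps) => i _; apply: (subZ Ps). Qed.

Definition enumerate (T : countType) (Y : T -> V) (q : nat) : V :=
  if unpickle q is Some c then Y c else 0.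

Lemma enumerate_in (T : countType) (Y : T -> V) c : cspan (enumerate Y) (Y c).
Proof. by have := cspan_in (enumerate Y) (pickle c); rewrite /enumerate pickleK. Qed.

Lemma enumerate_sub (T : countType) (Y : T -> V) (P : V -> Prop) q :
  P 0 -> (forall c, P (Y c)) -> P (enumerate Y q).
Proof. by move=> P0 PY; rewrite /enumerate; case: unpickle. Qed.

Definition entry n (z : 'cV[V]_n) (l : nat) : V := if insub l is Some i then z i 0 else 0.

Lemma entryE n (z : 'cV[V]_n) (i : 'I_n) : entry z i = z i 0.
Proof. by rewrite /entry; case: insubP => [u _ /ord_inj ->|]; rewrite ?ltn_ord. Qed.

Lemma entry_sub n (z : 'cV[V]_n) (P : V -> Prop) l : P 0 -> all_in P z -> P (entry z l).
Proof. by move=> P0 Pz; rewrite /entry; case: insub. Qed.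

End CountableSpans.

(** * Towers of finitely presented modules *)

Section Tower.
Variables (R : pzRingType) (BB : mclass R) (N : rmod R).
Local Notation S := (R^c).
Variables (n k : nat -> nat) (z : forall t, 'cV[N]_(n t)) (r : forall t, 'M[S]_(k t, n t)).
Variables (w : forall t, 'M[S]_(n t, n t.+1)) (e : forall t, 'M[S]_(k t, k t.+1)).
Hypothesis wz : forall t, w t *v z t.+1 = z t.
Hypothesis rz : forall t, r t *v z t = 0.
Hypothesis rw : forall t, r t *m w t = e t *m r t.+1.
Hypothesis zrel : forall t (rho : 'rV[S]_(n t)), rho *v z t = 0 ->
  exists d : 'rV[S]_(k t.+1), rho *m w t = d *m r t.+1.
Hypothesis zspan : forall y, exists t, rowspan (z t) y.

(** By [zrel] and [zspan], N is the limit of the modules presented by the [r t]. The condition on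
    [kills_ext] lifts each stage to E; two lifts differ by a map to B, and the last condition, of
    Mittag-Leffler type, allows the next lift to be corrected. Compatible lifts define a
    splitting. *)
Lemma tower_ext (B : rmod R) : BB B ->
  (forall t, kills_ext BB (r t) (r t.+1) (e t)) ->
  (forall t (h : 'cV[B]_(n t.+1)), r t.+1 *v h = 0 ->
    exists eta : 'cV[B]_(n t.+2), r t.+2 *v eta = 0 /\
      w t *v (w t.+1 *v eta) = w t *v h) ->
  Ext1_zero N B.
Proof.
move=> BBB kill dom E i p il pl ii ps ex.
have toB m (y : 'cV[E]_m) : map_mx p y = 0 -> exists b : 'cV[B]_m, map_mx i b = y.
  move=> py; have [b bE] : exists b : 'cV[B]_m, forall l, i (b l 0) = y l 0.
    apply: (@col_lift _ _ (fun u v => i v = u)) => l; apply/ex.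
    by have := congr1 (fun c : 'cV[N]_m => c l 0) py; rewrite !mxE.
  by exists b; apply: colP0 => l; rewrite mxE.
have pi0 m (b : 'cV[B]_m) : map_mx p (map_mx i b) = 0.
  by apply: colP0 => l; rewrite !mxE; apply/ex; exists (b l 0).
have map_i_inj m (b b' : 'cV[B]_m) : map_mx i b = map_mx i b' -> b = b'.
  move=> bb; apply: colP0 => l; apply: ii.
  by have := congr1 (fun c : 'cV[E]_m => c l 0) bb; rewrite !mxE.
pose Q t (y : 'cV[E]_(n t)) := map_mx p y = z t /\ r t *v y = 0.
(* A set-theoretic lift zh at stage t.+1 violates the relations by a tuple be of B. Restricted to
   stage t, the violation is that of a tuple ga of B, which is subtracted. *)
have lift t : exists y, Q t y.
  have [zh zhE] : exists zh : 'cV[E]_(n t.+1), forall l, p (zh l 0) = z t.+1 l 0.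
    by apply: (@col_lift _ _ (fun u v => p v = u)) => l; apply: ps.
  have {}zhE : map_mx p zh = z t.+1 by apply: colP0 => l; rewrite mxE.
  have [be beE] : exists be, map_mx i be = r t.+1 *v zh.
    by apply: toB; rewrite map_mact // zhE rz.
  have [|ga gaE] := kill t B BBB be.
    move=> d dr; apply: map_i_inj; rewrite map_mact // beE -mactA dr mact0l.
    by rewrite map_mx0_lin.
  exists (w t *v zh - map_mx i ga); split.
    by rewrite map_mxB_lin // map_mact // zhE wz pi0 subr0.
  rewrite mactBr -mactA rw mactA -beE -!map_mact // gaE.
  exact: subrr.
(* The lift [Y t] lives at stage t.+1, because consecutive lifts are made to agree only after
   restriction one stage further down. *)
have [Y0 Y0P] := lift 1%N.
have [|Y [_ YP]] := @choice_seq (fun t => 'cV[E]_(n t.+1)) (fun t => Q t.+1)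
    (fun t y y' => w t *v (w t.+1 *v y') = w t *v y) Y0 Y0P.
  move=> t y [py ry]; have [y2 [py2 ry2]] := lift t.+2.
  have [h hE] : exists h, map_mx i h = y - w t.+1 *v y2.
    by apply: toB; rewrite map_mxB_lin // map_mact // py py2 wz subrr.
  have [|eta [reta weta]] := dom t h.
    apply: map_i_inj; rewrite map_mact // hE mactBr ry -mactA rw mactA ry2 mact0r.
    by rewrite subrr map_mx0_lin.
  exists (y2 + map_mx i eta); split.
    split; first by rewrite map_mxD_lin // py2 pi0 addr0.
    by rewrite mactDr ry2 -map_mact // reta map_mx0_lin // addr0.
  rewrite !mactDr -!map_mact // weta map_mact // hE mactBr.
  by rewrite addrC subrK.
(* Restricted to stage t the lifts become strictly compatible. *)
pose D t := w t *v Y t.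
have DE t : D t = w t *v D t.+1 by have [_ ->] := YP t.
have pD t : map_mx p (D t) = z t by have [[pY _] _] := YP t; rewrite map_mact // pY wz.
have rD t : r t *v D t = 0.
  by have [[_ rY] _] := YP t; rewrite -mactA rw mactA rY mact0r.
clearbody D.
have raise t T : (t <= T)%N -> exists W : 'M[S]_(n t, n T), z t = W *v z T /\ D t = W *v D T.
  elim: T => [|T IH]; first by rewrite leqn0 => /eqP ->; exists 1%:M; rewrite !mact1.
  rewrite leq_eqVlt => /orP [/eqP ->|]; first by exists 1%:M; rewrite !mact1.
  move=> /IH [W [zW DW]]; exists (W *m w T).
  by rewrite !mactA wz -zW -DE.
have zD T (rho : 'rV[S]_(n T)) : rho *v z T = 0 -> rho *v D T = 0.
  move=> /zrel [d dE]; rewrite DE -mactA dE mactA rD mact0r //.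
have wd t t' (rho : 'rV[S]_(n t)) (rho' : 'rV[S]_(n t')) :
    rho *v z t = rho' *v z t' -> rho *v D t = rho' *v D t'.
  have [W [zW DW]] := raise t _ (leq_maxl t t').
  have [W' [zW' DW']] := raise t' _ (leq_maxr t t').
  rewrite zW zW' DW DW' -!mactA => /eqP; rewrite -subr_eq0 -mactBl => /eqP /zD.
  by rewrite mactBl => /eqP; rewrite subr_eq0 => /eqP.
have sex y : exists v, forall t (rho : 'rV[S]_(n t)), y = (rho *v z t) 0 0 -> v = (rho *v D t) 0 0.
  have [t [rho rhoE]] := zspan y; exists ((rho *v D t) 0 0) => t' rho' E'.
  congr (fun c : 'cV[E]_1 => c 0 0); apply: wd; apply: colP0 => l; rewrite !ord1.
  by rewrite -rhoE.
have [s sP] := choice sex; exists s; split=> [a x y|y].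
  have [t [rho rhoE]] := zspan x; have [t' [rho' rhoE']] := zspan y.
  have [W [zW DW]] := raise t _ (leq_maxl t t').
  have [W' [zW' DW']] := raise t' _ (leq_maxr t t').
  rewrite zW -mactA in rhoE; rewrite zW' -mactA in rhoE'.
  rewrite (sP _ _ _ rhoE) (sP _ _ _ rhoE') -mactZl -colD -mactDl; apply: sP.
  by rewrite mactDl colD mactZl -rhoE -rhoE'.
have [t [rho rhoE]] := zspan y; rewrite (sP _ _ _ rhoE) [in RHS]rhoE.
have -> : p ((rho *v D t) 0 0) = map_mx p (rho *v D t) 0 0 by rewrite [RHS]mxE.
by rewrite map_mact // pD.
Qed.

Lemma tower_count_presented (X : nat -> N) : (forall y, cspan X y) -> count_presented N.
Proof.
(* G is the full product; [fin ka y] says that ka has finite support and represents y, so relations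
   among the X are the ka with [fin ka 0]. *)
move=> Xgen; pose G := dprod (fun _ : nat => regmod R).
pose fin (ka : G) (y : N) := exists b, (forall i, (b <= i)%N -> ka i = 0) /\
  y = \sum_(i < b) (ka i : S) *: X i.
have fin_widen ka y b0 : fin ka y -> exists b, [/\ (b0 <= b)%N, forall i, (b <= i)%N -> ka i = 0
    & y = \sum_(i < b) (ka i : S) *: X i].
  move=> [b [kb ->]]; exists (maxn b0 b); split; first exact: leq_maxl.
    by move=> i; rewrite geq_max => /andP [_ /kb].
  rewrite (@sum_widen R N b (maxn b0 b) (fun i => (ka i : S) *: X i)) ?leq_maxr //.
  by move=> i /kb ->; rewrite scale0r.
have fin_lin a ka y ka' y' : fin ka y -> fin ka' y' -> fin (a *: ka + ka') (a *: y + y').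
  move=> fk fk'; have [b [_ kb yE]] := fin_widen _ _ 0%N fk.
  have [b' [bb kb' yE']] := fin_widen _ _ b fk'; exists b'; split.
    by move=> i ib; rewrite dprodE kb ?kb' ?scaler0 ?addr0 //; apply: leq_trans bb ib.
  rewrite yE yE' -(@sum_widen R N b b' (fun i => (ka i : S) *: X i)) //; last first.
    by move=> i /kb ->; rewrite scale0r.
  rewrite scaler_sumr -big_split; apply: eq_bigr => i _.
  by rewrite dprodE [RHS]scalerDl scalerA.
have fin_uniq ka y y' : fin ka y -> fin ka y' -> y = y'.
  move=> fk [b [kb ->]]; have [b' [bb kb' ->]] := fin_widen _ _ b fk.
  apply: (@sum_widen R N b b' (fun i => (ka i : S) *: X i)) => // i /kb ->.
  by rewrite scale0r.
have fin0 : fin 0 0 by exists 0%N; rewrite big_ord0.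
have finP : @is_sub R (G * N)%type (fun q => fin q.1 q.2).
  by split=> // a q q'; apply: fin_lin.
have finB ka y ka' y' : fin ka y -> fin ka' y' -> fin (ka - ka') (y - y').
  by move=> f1 f2; have := subB finP (x := (ka, y)) (y := (ka', y')) f1 f2.
have fin_mact m m' (a : 'M[S]_(m, m')) (ka : 'cV[G]_m') (y : 'cV[N]_m') :
    (forall l, fin (ka l 0) (y l 0)) -> forall l, fin ((a *v ka) l 0) ((a *v y) l 0).
  move=> fk l; rewrite !mactE; apply: (big_ind2 fin) => //.
    by move=> x1 x2 y1 y2 f1 f2; have := fin_lin 1 _ _ _ _ f1 f2; rewrite !scale1r.
  by move=> q _; have := fin_lin (a l q) _ _ _ _ (fk q) fin0; rewrite !addr0.
pose del i : G := @dsingle R nat (fun _ => regmod R) i (1 : S).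
have del_neq i j : i <> j -> del i j = 0 by move=> ij; apply: dsingle_neq.
have del_eq i : del i i = 1 by apply: dsingle_eq.
have fin_del i : fin (del i) (X i).
  exists i.+1; split=> [j ij|].
    by apply: del_neq => ij'; rewrite ij' ltnn in ij.
  rewrite big_ord_recr /= del_eq scale1r big1 ?add0r // => j _.
  rewrite del_neq ?scale0r // => ij.
  by have := ltn_ord j; rewrite -ij ltnn.
have expand ka y : fin ka y -> exists b, ka = \sum_(i < b) (ka i : S) *: del i.
  move=> [b [kb _]]; exists b; apply: dprod_ext => j.
  rewrite dprod_sum; have [jb|bj] := ltnP j b; last first.
    rewrite kb // big1 // => i _; rewrite dprodZ del_neq ?scaler0 // => ij.
    by have := ltn_ord i; rewrite ij ltnNge bj.
  rewrite (bigD1 (Ordinal jb)) //= big1 => [|i /eqP ij].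
    by rewrite addr0 dprodZ del_eq; apply/esym; apply: mulr1.
  rewrite dprodZ del_neq ?scaler0 // => ij'; apply: ij.
  by apply: val_inj.
have [v vP] : exists v : forall t, 'cV[G]_(n t), forall t l, fin (v t l 0) (z t l 0).
  have vex t : exists v : 'cV[G]_(n t), forall l, fin (v l 0) (z t l 0).
    apply: (@col_lift _ _ (fun y ka => fin ka y)) => l.
    have [m [c [_ cE c0]]] := cspan_widen 0 (Xgen (z t l 0)).
    by exists (c : G); exists m.
  by exists (fun t => projT1 (cid (vex t))) => t; apply: projT2 (cid (vex t)).
have uex i : exists tr : {t & 'rV[S]_(n t)}, X i = (projT2 tr *v z (projT1 tr)) 0 0.
  by have [t [c cE]] := zspan (X i); exists (existT _ t c).
have [u uP] := choice uex.
(* With [v t] a lift of [z t] to G, three countable families suffice: each generator in terms of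
   some stage, each stage in terms of the next, and the relations of every stage. *)
pose rel (c : (nat + (nat * nat) + (nat * nat))%type) : G := match c with
  | inl (inl i) => del i - (projT2 (u i) *v v (projT1 (u i))) 0 0
  | inl (inr tl) => entry (v tl.1 - w tl.1 *v v tl.1.+1) tl.2
  | inr tl => entry (r tl.1 *v v tl.1) tl.2 end.
have rel0 c : fin (rel c) 0.
  case: c => [[i|[t l]]|[t l]] /=.
  - rewrite -(subrr (X i)) {2}uP; apply: finB; first exact: fin_del.
    by apply: fin_mact => l; apply: vP.
  - apply: (@entry_sub R G _ _ (fun ka => fin ka 0)) => // q.
    rewrite colB -(subrr (z t q 0)) -{2}wz; apply: finB; first exact: vP.
    by apply: fin_mact => l'; apply: vP.
  - apply: (@entry_sub R G _ _ (fun ka => fin ka 0)) => // q.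
    have := fin_mact _ _ (r t) _ _ (vP t) q; by rewrite rz [X in fin _ X]mxE.
pose Rel := enumerate rel.
have Rel0 q : fin (Rel q) 0 by apply: (@enumerate_sub _ _ _ rel (fun ka => fin ka 0)).
have Ss := is_sub_cspan Rel.
have fs0 : @is_sub R G (fun ka => fin ka 0).
  by split=> // a x y fx fy; have := fin_lin a _ _ _ _ fx fy; rewrite scaler0 addr0.
have S0 ka : cspan Rel ka -> fin ka 0 by apply: (cspan_sub (P := fun ka => fin ka 0) fs0).
have up t T (ka : G) (rho : 'rV[S]_(n t)) : (t <= T)%N -> cspan Rel (ka - (rho *v v t) 0 0) ->
    exists rho' : 'rV[S]_(n T), cspan Rel (ka - (rho' *v v T) 0 0).
  move=> + Sk; elim: T => [|T IH]; first by rewrite leqn0 => /eqP t0; subst t; exists rho.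
  rewrite leq_eqVlt => /orP [/eqP t0|]; first by subst t; exists rho.
  move=> /IH [rho' S']; exists (rho' *m w T).
  rewrite -(subrK ((rho' *v v T) 0 0) ka) -addrA; apply: (subD Ss) => //.
  rewrite mactA -colB -mactBr; apply: all_in_mact => // l.
  by have := enumerate_in rel (inl (inr (T, l : nat))); rewrite /= entryE.
have low ka y : fin ka y -> exists t (rho : 'rV[S]_(n t)), cspan Rel (ka - (rho *v v t) 0 0).
  pose P (ka : G) := exists t (rho : 'rV[S]_(n t)), cspan Rel (ka - (rho *v v t) 0 0).
  have Ps : is_sub P.
    split=> [|a x x' [t [rho Sr]] [t' [rho' Sr']]].
      by exists 0%N, 0; rewrite mact0l mxE subr0; apply: (sub0 Ss).
    have [rh Srh] := up _ _ _ _ (leq_maxl t t') Sr.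
    have [rh' Srh'] := up _ _ _ _ (leq_maxr t t') Sr'.
    exists (maxn t t'), (a *: rh + rh'); rewrite mactDl colD mactZl opprD addrACA.
    by rewrite -scalerBr; apply: Ss.2.
  move=> fk; have [b ->] := expand _ _ fk; apply: (sub_sum Ps) => i _; apply: (subZ Ps).
  by exists (projT1 (u i)), (projT2 (u i)); apply: (enumerate_in rel (inl (inl (i : nat)))).
(* Modulo Rel, a relation becomes a combination rho of [v t], and then rho kills [z t]; by [zrel] it
   is a combination of the relations of stage t.+1. *)
have key ka : fin ka 0 -> cspan Rel ka.
  move=> fk; have [t [rho Sr]] := low _ _ fk.
  have rz0 : rho *v z t = 0.
    apply: colP0 => l; rewrite !ord1 [RHS]mxE.
    have f1 := finB _ _ _ _ fk (fin_mact _ _ rho _ _ (vP t) 0).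
    by have := fin_uniq _ _ _ f1 (S0 _ Sr); rewrite sub0r => /eqP; rewrite oppr_eq0 => /eqP.
  have [d dE] := zrel rz0.
  have -> : ka = (ka - (rho *v v t) 0 0) + ((rho *v (v t - w t *v v t.+1)) 0 0
                  + (d *v (r t.+1 *v v t.+1)) 0 0).
    by rewrite -[d *v _]mactA -dE mactA -colD -mactDr subrK subrK.
  apply: (subD Ss) => //; apply: (subD Ss); apply: all_in_mact => // l.
    by have := enumerate_in rel (inl (inr (t, l : nat))); rewrite /= entryE.
  by have := enumerate_in rel (inr (t.+1, l : nat)); rewrite /= entryE.
have [b bP] := choice Rel0.
exists X, b, (fun q i => Rel q i : S); split=> //; split=> [q|m c c0].
  by have [_ <-] := bP q.
have [|M [d dE]] := key (fun i => if (i < m)%N then c i else 0).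
  exists m; split=> [i mi|]; first by rewrite ltnNge mi.
  by rewrite -[LHS]c0; apply: eq_bigr => i _; rewrite ltn_ord.
exists M, d => i; have := congr1 (fun ka : G => ka i) dE => /= ->.
have -> : (\sum_(q < M) d q *: Rel q) i = \sum_(q < M) (d q * (Rel q i : S)) :> S.
  by rewrite dprod_sum.
apply: eq_bigr => q _; congr (_ * _).
by have [bq _] := bP q; case: ltnP => // /bq.
Qed.

End Tower.

(** * Stationary approximable modules are locally free *)

Section Dominates.
Variables (R : pzRingType) (BB : mclass R).
Local Notation S := (R^c).
Implicit Types M B : rmod R.

(** A formula about [u x] is a formula about x; the block matrices express it with x itself among
    the unknowns. *)
Lemma dominates_mact M a n k (x : 'cV[M]_a) (w : 'M[S]_(a, n)) (r : 'M[S]_(k, n))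
    a' (u : 'M[S]_(a', a)) :
  dominates BB x w r -> dominates BB (u *v x) (u *m w) r.
Proof.
move=> dx B BBB b [zb [wzb rzb]] n' k' w' r' [ze [wze rze]].
have [||y [yE ry]] := dx B BBB (w *v zb) _ _ _ (row_mx 1%:M (0 : 'M[S]_(a, n')))
    (col_mx (row_mx u (- w')) (row_mx 0 r')).
- by exists zb.
- exists (col_mx x ze); rewrite mact_col !mact_row !mact0l mact1 addr0 rze addr0.
  split=> //; rewrite -[- w']sub0r mactBl mact0l wze sub0r subrr; exact: col_mx0.
move: yE ry; rewrite -[y]vsubmxK; set y1 := usubmx y; set y2 := dsubmx y.
rewrite mact_col !mact_row !mact0l mact1 addr0 add0r => y1E.
rewrite -col_mx0 => /eq_col_mx [uy ry2]; exists y2; split=> //.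
move: uy; rewrite -[- w']sub0r mactBl mact0l sub0r => /eqP; rewrite subr_eq0 => /eqP <-.
by rewrite y1E -mactA.
Qed.

(** The equation [r w' = e r'] makes w' a map between the presented modules, so the new formula
    implies the old one. *)
Lemma dominates_refine M a n k (x : 'cV[M]_a) (w : 'M[S]_(a, n)) (r : 'M[S]_(k, n))
    n' k' (w' : 'M[S]_(n, n')) (r' : 'M[S]_(k', n')) (e : 'M[S]_(k, k')) :
  r *m w' = e *m r' -> dominates BB x w r -> dominates BB x (w *m w') r'.
Proof.
move=> E dx B BBB b [z [wz rz]]; apply: dx => //; exists (w' *v z).
by rewrite -!mactA wz E mactA rz mact0r.
Qed.

(* The relations of x in M already hold in the module presented by r, because
   that module is cogenerated by character modules. *)
Lemma dominates_rel M a n k (x : 'cV[M]_a) (w : 'M[S]_(a, n)) (r : 'M[S]_(k, n))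
    m (rho : 'M[S]_(m, a)) : BB (charmod R) ->
  dominates BB x w r -> rho *v x = 0 -> exists d : 'M[S]_(m, k), rho *m w = d *m r.
Proof.
move=> BC dx rx.
have rowE (c : 'rV[S]_a) : c *v x = 0 -> relspan r (c *m w).
  move=> cx; apply: contrapT => nr.
  have [|h [hl h0]] := @charmod_cogenerates R (finpres r) (fppi r (c *m w)).
    by move=> /(@sqpi_ker _ _ (quodata (is_sub_relspan r)) _ Logic.I).
  apply: h0; have [||y [yE cy]] := dx _ BC (w *v map_mx h (fpgen r)) _ _ _ 1%:M c.
  - by exists (map_mx h (fpgen r)); split=> //; rewrite -map_mact // fpgen_rel map_mx0_lin.
  - by exists x; rewrite mact1.
  rewrite mact1 in yE; rewrite fppiE.
  have -> : h ((c *m w *v fpgen r) 0 0) = map_mx h (c *m w *v fpgen r) 0 0 by rewrite [RHS]mxE.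
  by rewrite map_mact // mactA -yE cy mxE.
have /choice [d dE] l : relspan r (row l rho *m w).
  apply: rowE; apply: colP0 => q; have := congr1 (fun y : 'cV[M]_m => y l 0) rx.
  by rewrite !mactE !mxE => E; rewrite -[RHS]E; apply: eq_bigr => i _; rewrite mxE.
exists (\matrix_l d l); apply/row_matrixP => l.
by rewrite !row_mul rowK dE.
Qed.

End Dominates.

Section StationaryLocallyFree.
Variables (R : pzRingType) (A BB : mclass R).
Local Notation S := (R^c).
Hypothesis cot : cotorsion_pair A BB.
Variable M : rmod R.

Lemma charmod_BB : BB (charmod R).
Proof. by apply/cot.2 => N _; apply: charmod_injective. Qed.

(** Both finitary conditions at once, with witnesses inside L. Only finite tuples occur, so the
    property passes to unions of chains. *)
Definition good_sub (L : M -> Prop) := forall a m (x : 'cV[M]_a) (s : 'M[S]_(m, a)),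
  all_in L x -> s *v x = 0 ->
  exists n k (w : 'M[S]_(a, n)) (r : 'M[S]_(k, n)) (e : 'M[S]_(m, k)) (z : 'cV[M]_n),
    [/\ all_in L z, w *v z = x, r *v z = 0, s *m w = e *m r &
        kills_ext BB s r e /\ dominates BB x w r].

Lemma good_whole : pp_dominated BB M -> ext_approximable BB M -> good_sub (@whole R M).
Proof.
move=> dM eM a m x s _ sx.
have [n1 [k1 [w1 [r1 [z1 [wz1 rz1 d1]]]]]] := dM a x.
(* Condition (E) is applied to the module given by (S) with the relations [s w1] adjoined; the lower
   block of e then kills Ext^1 for s, and the upper block shows that domination is kept. *)
pose r1' := col_mx r1 (s *m w1).
have rz1' : r1' *v z1 = 0 by rewrite mact_col rz1 mactA wz1 sx col_mx0.
have [n [k [w [r [e [z [wz rz rw ke]]]]]]] := eM _ _ z1 r1' rz1'.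
have [rw1 rw2] : r1 *m w = usubmx e *m r /\ s *m w1 *m w = dsubmx e *m r.
  by move: rw; rewrite mul_col_mx -[e]vsubmxK mul_col_mx => /eq_col_mx; rewrite vsubmxK.
exists n, k, (w1 *m w), r, (dsubmx e), z; split=> //.
- by rewrite mactA wz wz1.
- by rewrite mulmxA.
split; last by apply: dominates_refine d1; exact: rw1.
move=> B BBB be bc; have [ga] := ke B BBB be bc.
rewrite mact_col -[e]vsubmxK mact_col => /eq_col_mx [_ E].
by exists (w1 *v ga); rewrite -mactA E vsubmxK.
Qed.

Lemma good_zero : good_sub (fun x => x = 0).
Proof.
move=> a m x s x0 _; have {x0} -> : x = 0 by apply: colP0 => i; rewrite mxE.
exists 0%N, 0%N, 0, 0, 0, 0; split.
- by case.
- exact: mact0l.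
- exact: mact0l.
- by rewrite mulmx0 mul0mx.
split=> [B BBB be _|B BBB b [z [<- _]] n' k' w' r' _].
  by exists 0; rewrite mact0r mact0l.
by exists 0; rewrite !mact0r mact0l.
Qed.

(** The family that will witness local freeness; that its members lie in A and are countably
    presented comes from [good_tower]. *)
Definition good_member (L : M -> Prop) :=
  [/\ is_sub L, exists X, forall y, L y <-> cspan X y & good_sub L].

Section GoodTower.
Variables (L : M -> Prop) (X : nat -> M).
Hypotheses (Ls : is_sub L) (gL : good_sub L) (LX : forall t, L (X t)).

Let state := {n : nat & {k : nat & ('cV[M]_n * 'M[S]_(k, n))%type}}.
Let sn (st : state) : nat := projT1 st.
Let sk (st : state) : nat := projT1 (projT2 st).
Let sz (st : state) : 'cV[M]_(sn st) := (projT2 (projT2 st)).1.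
Let sr (st : state) : 'M[S]_(sk st, sn st) := (projT2 (projT2 st)).2.
Let link t (st st' : state) := exists (w : 'M[S]_(sn st, sn st')) (e : 'M[S]_(sk st, sk st')),
  [/\ w *v sz st' = sz st, sr st *m w = e *m sr st', kills_ext BB (sr st) (sr st') e,
      dominates BB (sz st) w (sr st') & rowspan (sz st') (X t)].
Let valid (st : state) := all_in L (sz st) /\ sr st *v sz st = 0.

Let link_ex t st : valid st -> exists st', valid st' /\ link t st st'.
Proof.
case: st => n [k [z r]] [/= Lz rz].
(* The next element X t joins the tuple as a new generator without relations, hence the zero
   column. *)
pose x := col_mx z (single (X t)); pose s := row_mx r (0 : 'M[S]_(k, 1)).
have Lx : all_in L x by apply: all_in_col => // i; rewrite mxE.
have sx : s *v x = 0 by rewrite mact_row mact0l addr0.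
have [n' [k' [w [r' [e [z' [Lz' wz' rz' sw [ke dw]]]]]]]] := gL Lx sx.
have [wz1 wz2] : usubmx w *v z' = z /\ dsubmx w *v z' = single (X t).
  by move: wz'; rewrite -{1}[w]vsubmxK mact_col => /eq_col_mx.
exists (existT _ n' (existT _ k' (z', r'))); split; first by split.
exists (usubmx w), e; split=> //.
- by rewrite -sw -{2}[w]vsubmxK mul_row_col mul0mx addr0.
- move=> B BBB be bc; have [ga gaE] := ke B BBB be bc; exists (usubmx ga).
  by move: gaE; rewrite -{1}[ga]vsubmxK mact_row mact0l addr0.
- have := dominates_mact (u := row_mx 1%:M (0 : 'M[S]_(n, 1))) dw; rewrite mact_row mact1 mact0l addr0.
  by rewrite -{1}[w]vsubmxK mul_row_col mul1mx mul0mx addr0.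
- by exists (dsubmx w); rewrite wz2 mxE.
Qed.

(** It serves twice: for L = M it puts an arbitrary sequence X into a good member, and for a good
    member L generated by X it returns L itself, now as the union of a tower. *)
Lemma good_tower : exists L' : M -> Prop, [/\ good_member L', forall t, L' (X t),
  forall y, L' y -> L y &
  (forall y, L' y -> cspan X y) -> submodule_in (countable_part A) L'].
Proof.
have v0 : valid (existT _ 0%N (existT _ 0%N (0, 0))) by split=> [[]|]; last exact: mact0l.
have [st [_ stP]] := @choice_seq (fun _ => state) (fun _ => valid) link _ v0 link_ex.
pose n t := sn (st t); pose k t := sk (st t).
pose z t : 'cV[M]_(n t) := sz (st t); pose r t : 'M[S]_(k t, n t) := sr (st t).
have lk t := (stP t).2.
pose w t : 'M[S]_(n t, n t.+1) := projT1 (cid (lk t)).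
pose e t : 'M[S]_(k t, k t.+1) := projT1 (cid (projT2 (cid (lk t)))).
have weP t : [/\ w t *v z t.+1 = z t, r t *m w t = e t *m r t.+1,
    kills_ext BB (r t) (r t.+1) (e t), dominates BB (z t) (w t) (r t.+1) &
    rowspan (z t.+1) (X t)] := projT2 (cid (projT2 (cid (lk t)))).
have rz t : r t *v z t = 0 by have [[]] := stP t.
have Lz t : all_in L (z t) by have [[]] := stP t.
clearbody w e n k z r.
pose L' y := exists t, rowspan (z t) y.
have up t T y : (t <= T)%N -> rowspan (z t) y -> rowspan (z T) y.
  move=> + yt; elim: T => [|T IH]; first by rewrite leqn0 => /eqP <-.
  rewrite leq_eqVlt => /orP [/eqP <- //|/IH].
  by have [<- _ _ _ _] := weP T; apply: rowspan_mact.
have L's : is_sub L'.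
  split=> [|a x y [t tx] [t' ty]]; first by exists 0%N; apply: (sub0 (is_sub_rowspan _)).
  exists (maxn t t'); apply: (is_sub_rowspan _).2.
    exact: up (leq_maxl _ _) tx.
  exact: up (leq_maxr _ _) ty.
have tup m (y : 'cV[M]_m) : all_in L' y -> exists t (c : 'M[S]_(m, n t)), y = c *v z t.
  move=> /choice [c cP]; exists (\max_l c l)%N; apply/all_in_rowspan => l.
  by apply: up (cP l); apply: leq_bigmax.
have rel t m (rho : 'M[S]_(m, n t)) : rho *v z t = 0 ->
    exists d : 'M[S]_(m, k t.+1), rho *m w t = d *m r t.+1.
  by have [_ _ _ dw _] := weP t; apply: dominates_rel dw; exact: charmod_BB.
exists L'; split.
- split=> //.
    pose Y (tl : (nat * nat)%type) := entry (z tl.1) tl.2.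
    exists (enumerate Y) => y; split=> [[t ty]|].
      apply: (rowspan_sub (is_sub_cspan _) _ ty) => l.
      by have := enumerate_in Y (t, l : nat); rewrite /Y /= entryE.
    apply: cspan_sub => // q; apply: enumerate_sub; first exact: (sub0 L's).
    move=> [t l]; apply: entry_sub; first exact: (sub0 L's).
    by move=> i; exists t; apply: rowspan_in.
  move=> a m x s /tup [t [c ->]] sx.
  (* The relations s among the [c *v z t] hold after one step of the tower, and the following step
     kills Ext^1; so the witnesses are taken from stage t.+2. *)
  have [d dE] : exists d : 'M[S]_(m, k t.+1), s *m c *m w t = d *m r t.+1.
    by apply: rel; rewrite mactA.
  have [wz rw ke dw _] := weP t; have [wz' rw' ke' dw' _] := weP t.+1.
  exists (n t.+2), (k t.+2), (c *m w t *m w t.+1), (r t.+2), (d *m e t.+1), (z t.+2).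
  split=> //.
  - by move=> l; exists t.+2; apply: rowspan_in.
  - by rewrite !mactA wz' wz.
  - by rewrite !mulmxA dE -!mulmxA rw'.
  split; last by apply: (dominates_refine rw'); apply: dominates_mact.
  move=> B BBB be bc; have [ga gaE] := ke' B BBB be bc.
  by exists (c *m w t *v ga); rewrite -mactA mulmxA dE !mactA gaE.
- by move=> t; have [_ _ _ _ Xt] := weP t; exists t.+1.
- by move=> y [t]; apply: rowspan_sub.
move=> Xgen; pose N := SQ (subdata L's); pose pi := sqpi (subdata L's) : M -> N.
have vl : is_lin (fun q : N => sqval q) := @subdata_val_lin _ _ _ L's.
have piK y : L' y -> sqval (pi y) = y by apply: subdata_piK.
have valI m (y y' : 'cV[N]_m) : map_mx (fun q : N => sqval q) y = map_mx (fun q : N => sqval q) y' -> y = y'.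
  move=> E; apply: colP0 => l; apply: sqval_inj.
  by have := congr1 (fun c : 'cV[M]_m => c l 0) E; rewrite !mxE.
pose ze t : 'cV[N]_(n t) := map_mx pi (z t).
have vze t : map_mx (fun q : N => sqval q) (ze t) = z t.
  by apply: colP0 => l; rewrite !mxE piK //; exists t; apply: rowspan_in.
have wze t : w t *v ze t.+1 = ze t.
  by apply: valI; rewrite map_mact // !vze; have [] := weP t.
have rze t : r t *v ze t = 0.
  by apply: valI; rewrite map_mact // !vze rz map_mx0_lin.
have rw t : r t *m w t = e t *m r t.+1 by have [] := weP t.
have zrel t (rho : 'rV[S]_(n t)) : rho *v ze t = 0 ->
    exists d : 'rV[S]_(k t.+1), rho *m w t = d *m r t.+1.
  by move=> E; apply: rel; rewrite -vze -map_mact // E map_mx0_lin.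
have zspan (y : N) : exists t, rowspan (ze t) y.
  have [t [c cE]] := sqval_in y; exists t, c; apply: sqval_inj; rewrite cE -vze.
  by rewrite -(map_mact _ _ vl) mxE.
exists N, (fun q : N => sqval q); split; last first.
  split=> //; split; first exact: sqval_inj.
  move=> x; split=> [Lx|[y <-]]; last exact: (sqval_in y).
  by exists (pi x); apply: piK.
split; last first.
  apply: (tower_count_presented wze rze zrel zspan (X := fun t => pi (X t))) => y.
  have [m [c cE]] := Xgen _ (sqval_in y); exists m, c; apply: sqval_inj.
  rewrite (lin_sum vl) cE; apply: eq_bigr => i _; rewrite (linZ vl) piK //.
  by have [_ _ _ _ Xt] := weP i; exists i.+1.
apply/cot.1 => B BBB; apply: (tower_ext wze rze rw zrel zspan BBB).
  by move=> t; have [] := weP t.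
(* The tuple [w t *v h] satisfies the formula that dominates [z t], hence also the formula of stage
   t.+2, which [z t] satisfies in M; its solution is eta. *)
move=> t h rh; have [_ _ _ dw _] := weP t.
have [||eta [etaE reta]] := dw B BBB (w t *v h) _ _ _ (w t *m w t.+1) (r t.+2).
- by exists h.
- by exists (z t.+2); rewrite mactA; have [-> _ _ _ _] := weP t.+1; have [-> _ _ _ _] := weP t.
by exists eta; rewrite -mactA.
Qed.

End GoodTower.

Lemma approximable_locally_free :
  pp_dominated BB M -> ext_approximable BB M -> locally_free A M.
Proof.
move=> dM eM; exists good_member; split.
  move=> L [Ls [X XE] gL].
  have LX t : L (X t) by apply/XE; apply: cspan_in.
  have [L' [[L's _ _] L'X L'L sub]] := good_tower Ls gL LX.
  have LL' y : L y -> L' y by move=> /XE; apply: cspan_sub.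
  have [|N' [f [AN [fl [fi fE]]]]] := sub; first by move=> y /L'L /XE.
  exists N', f; split=> //; split=> //; split=> // x.
  by split=> [/LL' /fE|/fE /L'L].
split.
  exists (fun x => x = 0); split=> //; split; first exact: is_sub_eq0.
    exists (fun _ => 0) => y; split=> [->|]; first exact: (sub0 (is_sub_cspan _)).
    by move=> [n [c ->]]; rewrite big1 // => i _; rewrite scaler0.
  exact: good_zero.
split.
  move=> C gC chain; exists (fun x => exists n, C n x); split=> //.
  have Cs n : is_sub (C n) by have [] := gC n.
  have Us : is_sub (fun x => exists n, C n x).
    split=> [|a x y [m Cx] [n Cy]]; first by exists 0%N; apply: sub0.
    have [mn|nm] := chain m n; first by exists n; apply: (Cs n).2 => //; apply: mn.
    by exists m; apply: (Cs m).2 => //; apply: nm.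
  split=> //.
    have Xex n : exists X, forall y, C n y <-> cspan X y by have [] := gC n.
    have [X XE] := choice Xex; pose Y (tl : (nat * nat)%type) := X tl.1 tl.2.
    exists (enumerate Y) => y; split=> [[n /XE Cy]|].
      apply: (cspan_sub (is_sub_cspan _) _ Cy) => i.
      exact: (enumerate_in Y (n, i)).
    apply: (cspan_sub Us) => q.
    apply: (enumerate_sub (P := fun y => exists n, C n y)); first exact: (sub0 Us).
    by move=> [n i]; exists n; apply/XE; apply: cspan_in.
  move=> a m x s Ux sx.
  have [n Cx] : exists n, all_in (C n) x.
    have [c cP] := choice Ux.
    have [|n nP] := @directed_bound nat (fun i j => forall y, C i y -> C j y) a c.
      split; first by exists 0%N.
      split=> //; split=> [i j k ij jk y /ij /jk //|i j].
      by have [ij|ji] := chain i j; [exists j | exists i].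
    by exists n => l; apply: nP.
  have [_ _ gn] := gC n.
  have [n' [k [w [r [e [z [Cz wz rz sw ke]]]]]]] := gn _ _ x s Cx sx.
  by exists n', k, w, r, e, z; split=> // l; exists n.
move=> X; have [L [gL LX _ _]] := good_tower (is_sub_whole M) (good_whole dM eM) (fun t => Logic.I : whole (X t)).
by exists L.
Qed.

End StationaryLocallyFree.

(** * The equivalence, and closure under pure submodules *)

Theorem theorem4p5 (R : pzRingType) (A B : mclass R) :
  cotorsion_pair A B -> closed_dirlim B ->
  (forall M : rmod R,
     locally_free A M <->
     (stationary B M /\
      exists (N : rmod R) (p : N -> M), A N /\ pure_epi p)) /\
  (forall (M N : rmod R) (e : N -> M),
     locally_free A M -> pure_mono e -> locally_free A N).
Proof.
move=> cot clB.
have epi_approx (M N : rmod R) (p : N -> M) : A N -> pure_epi p -> ext_approximable B M.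
  by move=> AN pe; apply: (ext_approximable_pure_epi pe); apply: (cot_ext_approximable cot clB).
split=> [M|M N e lfM pe].
  split=> [lfM|[st [N [p [AN pe]]]]].
    split; last exact: (locally_free_pure_epi cot).
    by apply: pp_dominated_stationary; apply: (locally_free_pp_dominated cot clB).
  apply: (approximable_locally_free cot); first exact: (stationary_pp_dominated cot).
  exact: epi_approx pe.
have [N' [p [AN' pp]]] := locally_free_pure_epi cot lfM.
apply: (approximable_locally_free cot).
  by apply: (pp_dominated_pure pe); apply: (locally_free_pp_dominated cot clB).
by apply: (ext_approximable_pure pe); apply: epi_approx pp.
Qed.
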